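(* Let $(X_n)_{n\ge 0}$ be a Galton--Watson process with immigration such that $\xi$ and $\varepsilon$ are regularly varying with index $\gamma \in [1,\infty)$ (the same index for both), $\mathbb{P}(\xi > x) = \mathrm{O}(\mathbb{P}(\varepsilon > x))$ as $x \to \infty$, and there exists $r \in (\gamma,\infty)$ with $\mathbb{E}(X_0^r) < \infty$. In case of $\gamma = 1$, assume additionally that $m_\xi \in (0,\infty)$ and $m_\varepsilon \in (0,\infty)$. Then for each $n \in \mathbb{N}$, we have $$\mathbb{P}(X_n > x) \sim \mathbb{E}(X_0)\, m_\xi^{n-1} \sum_{i=0}^{n-1} m_\xi^{i(\gamma-1)}\, \mathbb{P}(\xi > x) + m_\varepsilon \sum_{j=1}^{n-1} m_\xi^{n-j-1} \sum_{i=0}^{n-j-1} m_\xi^{i(\gamma-1)}\, \mathbb{P}(\xi > x) + \sum_{j=1}^n m_\xi^{(n-j)\gamma}\, \mathbb{P}(\varepsilon > x)$$ as $x \to \infty$, and hence $X_n$ is also regularly varying with index $\gamma$.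
   Context: A Galton--Watson process with immigration is a stochastic process $(X_n)_{n\ge 0}$ given by $X_n = \sum_{i=1}^{X_{n-1}} \xi_{n,i} + \varepsilon_n$, $n \ge 1$, where $\{X_0, \xi_{n,i}, \varepsilon_n : n,i \ge 1\}$ are independent non-negative integer-valued random variables, the $\xi_{n,i}$ ($n,i\ge1$) are identically distributed, the $\varepsilon_n$ ($n\ge 1$) are identically distributed, and $\sum_{i=1}^0 := 0$. Here $\xi$ and $\varepsilon$ denote random variables with the distribution of $\xi_{1,1}$ and $\varepsilon_1$, respectively, and $m_\xi := \mathbb{E}(\xi) \in [0,\infty]$, $m_\varepsilon := \mathbb{E}(\varepsilon) \in [0,\infty]$. Empty sums are $0$; $\mathbb{N} = \{1,2,\ldots\}$. A non-negative random variable $X$ is regularly varying with index $\alpha \in [0,\infty)$ if $\mathbb{P}(X > x) > 0$ for all $x > 0$ and $\lim_{x\to\infty} \mathbb{P}(X > qx)/\mathbb{P}(X > x) = q^{-\alpha}$ for all $q > 0$. $f(x) \sim g(x)$ as $x\to\infty$ means $\lim_{x\to\infty} f(x)/g(x) = 1$, and $f(x) = \mathrm{O}(g(x))$ as $x\to\infty$ means $\limsup_{x\to\infty} f(x)/g(x) < \infty$. *)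

(* Defs.v *)
From HB Require Import structures.
From mathcomp Require Import all_boot all_order all_algebra finmap.
From mathcomp Require Import all_classical all_reals all_analysis.

Set Implicit Arguments.
Unset Strict Implicit.
Unset Printing Implicit Defensive.

Import Order.TTheory GRing.Theory Num.Theory.
Import numFieldNormedType.Exports.

Local Open Scope classical_set_scope.
Local Open Scope ring_scope.

Section random_variables.
Context d (T : measurableType d) (R : realType) (P : probability T R).

Definition tail (Y : T -> R) (x : R) : R := fine (P [set w | x < Y w]).

Definition regularly_varying (Y : T -> R) (alpha : R) : Prop :=
  [/\ measurable_fun setT Y /\ (forall w, 0 <= Y w),
      0 <= alpha,
      forall x, 0 < x -> 0 < tail Y x
    & forall q, 0 < q ->
        tail Y (q * x) / tail Y x @[x --> +oo] --> q `^ (- alpha)].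

Definition independent_family d' (T' : measurableType d') (I : choiceType)
    (D : set I) (Y : I -> {RV P >-> T'}) : Prop :=
  forall (J : {fset I}) (B : I -> set T'), [set` J] `<=` D ->
    (forall i, i \in J -> measurable (B i)) ->
    P (\bigcap_(i in [set` J]) Y i @^-1` B i) =
    (\prod_(i <- J) P (Y i @^-1` B i))%E.

Definition identically_distributed d' (T' : measurableType d')
    (Y Z : {RV P >-> T'}) : Prop :=
  forall B, measurable B -> distribution P Y B = distribution P Z B.

Definition toR (Y : T -> nat) : T -> R := fun w => (Y w)%:R.

(* The family X_0, xi_{n,i}, eps_n; the values of [xi] and [eps] at index 0
   are junk and are excluded by [gwi_index]. *)
Definition gwi_family (X0 : {RV P >-> nat}) (xi : nat -> nat -> {RV P >-> nat})
    (eps : nat -> {RV P >-> nat}) (k : unit + nat * nat + nat) :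
    {RV P >-> nat} :=
  match k with
  | inl (inl _) => X0
  | inl (inr (n, i)) => xi n i
  | inr n => eps n
  end.

Definition gwi_index : set (unit + nat * nat + nat)%type :=
  [set k | match k with
           | inl (inl _) => true
           | inl (inr (n, i)) => (0 < n)%N && (0 < i)%N
           | inr n => (0 < n)%N
           end].

(* Galton-Watson process with immigration. *)
Definition is_gwi (X : nat -> {RV P >-> nat})
    (xi : nat -> nat -> {RV P >-> nat}) (eps : nat -> {RV P >-> nat}) : Prop :=
  [/\ independent_family gwi_index (gwi_family (X 0%N) xi eps),
      forall n i, (0 < n)%N -> (0 < i)%N ->
        identically_distributed (xi n i) (xi 1%N 1%N),
      forall n, (0 < n)%N -> identically_distributed (eps n) (eps 1%N)
    & forall n, (0 < n)%N -> forall w,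
        X n w = (\sum_(1 <= i < (X n.-1 w).+1) xi n i w + eps n w)%N].

End random_variables.

Section asymptotics.
Context (R : realType).

(* Quotient forms at +oo; meant for [g] positive near +oo, as x / 0 = 0. *)
Definition asymp_equiv (f g : R -> R) : Prop := f x / g x @[x --> +oo] --> (1 : R).

Definition asymp_bigO (f g : R -> R) : Prop :=
  (limf_esup (fun x => (f x / g x)%:E) (pinfty_nbhs R) < +oo)%E.

End asymptotics.

(* Main.v *)
Require Import Defs.
From HB Require Import structures.
From mathcomp Require Import all_boot all_order all_algebra finmap.
From mathcomp Require Import all_classical all_reals all_analysis.
From mathcomp Require Import measurable_realfun.
From mathcomp Require Import lra ring.

Set Implicit Arguments.
Unset Strict Implicit.
Unset Printing Implicit Defensive.

Import Order.TTheory GRing.Theory Num.Theory.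
Import numFieldNormedType.Exports.

Local Open Scope classical_set_scope.
Local Open Scope ring_scope.

(** Write [F] and [H] for the tails of the offspring and of the immigration
    law, [m] for the offspring mean and [S_k] for a sum of [k] independent
    offspring variables. Everything is measured against [H]: since
    [F = O(H)], it suffices to show, by induction on [n], that
      [P (X_n > x) = c_n F(x) + d_n H(x) + o(H(x))],
    where [c_0 = d_0 = 0], [c_(n+1) = E(X_n) + m^gamma c_n] and
    [d_(n+1) = m^gamma d_n + 1]. The closed forms of [c_n] and [d_n] are
    elementary, and regular variation of [X_n] follows because [d_n >= 1]. The
    base case says that the tail of [X_0] is [o(H)], which is Markov's
    inequality for the moment of order [r > gamma] ([negl_power_tail]).

    The inductive step adds an independent immigration term, which only adds
    its tail ([tail_add_negl]), to a random sum [S_N] with [N = X_n], for which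
      [P (S_N > x) = E(N) F(x) + P (N > x / m) + o(H(x))]
    ([tail_rsum_negl]): a large random sum is due either to one large summand
    or to a large number of summands. To see this, split according to [N].
    - If [N > (1 + delta) x / m], then [S_N > x] up to a vanishing probability
      ([prob_psum_le], a lower large deviation bound).
    - The values of [N] between [(1 - delta) x / m] and [(1 + delta) x / m]
      carry little mass compared with [H], since the tail of [N] hardly changes
      when its argument is scaled by a factor close to 1 ([rv_class_shrink],
      [rv_class_grow]).
    - If [N = k <= (1 - delta) x / m], then [S_k > x] forces a deviation
      [S_k - k m >= delta x], whose probability is at most [C k F(x)], uniformly
      in [k] ([tail_psum_le]). For fixed [k] it is equivalent to [k F(x)]
      ([tail_psum_negl]), so that these terms add up to [E(N) F(x)].

    The uniform bound must also cover index 1, where the offspring variance is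
    infinite and only the mean is available. It comes from a Chernoff bound for
    summands truncated at a quarter of the deviation, with an exponent that is
    proportional to the logarithm of the target [k F(y)]; besides the mean, it
    only uses that [F(x) <= C F(2 x)].

    On the probabilistic side, [X_n] is a countable combination of variables of
    the generations up to [n], hence independent of all later ones
    ([indep_of_past]). *)

(** * Events independent of a family of random variables *)

Section independence.
Context d (T : measurableType d) (R : realType) (P : probability T R).
Context (I : choiceType) (Y : I -> {RV P >-> nat}).

(** Independence of an event [A] from the variables [Y i], [i] in [D],
    together with mutual independence of these variables on [A]. For [A = setT]
    it is mutual independence of the family; unlike independence of two
    sigma-algebras, it can be consumed one variable at a time
    ([indep_of_setI]). *)
Definition indep_of (D : set I) (A : set T) : Prop :=
  measurable A /\
  forall (s : seq I) (B : I -> set nat), uniq s -> [set` s] `<=` D ->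
    P (A `&` \bigcap_(i in [set` s]) Y i @^-1` B i) =
    (P A * \prod_(i <- s) P (Y i @^-1` B i))%E.

Lemma measurable_rv_preimage (Z : {RV P >-> nat}) (B : set nat) :
  measurable (Z @^-1` B).
Proof. by apply: measurable_funPTI. Qed.

Lemma measurable_cylinder (s : seq I) (B : I -> set nat) :
  measurable (\bigcap_(i in [set` s]) Y i @^-1` B i).
Proof.
rewrite bigcap_seq; apply: bigsetI_measurable => i _.
exact: measurable_rv_preimage.
Qed.

Lemma indep_of_subset (D D' : set I) (A : set T) :
  D' `<=` D -> indep_of D A -> indep_of D' A.
Proof.
by move=> sub [mA iA]; split=> // s B us sD; apply: iA => //; apply: subset_trans sub.
Qed.

(** A variable moves from the family into the event: apply the product
    rule to [i] and [s] together, and once more to [i] alone. *)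
Lemma indep_of_setI (D : set I) (A : set T) (i : I) (B : set nat) :
  D i -> indep_of D A -> indep_of (D `\ i) (A `&` Y i @^-1` B).
Proof.
move=> Di [mA iA]; split; first exact/measurableI/measurable_rv_preimage.
move=> s C us sD.
have si : i \notin s by apply/negP => /sD[_]; exact.
have PAB : P (A `&` Y i @^-1` B) = (P A * P (Y i @^-1` B))%E.
  have := iA [:: i] (fun=> B) isT.
  by rewrite set_cons1 bigcap_set1 big_seq1 => -> // j ->.
pose C' j := if j == i then B else C j.
have CE : {in s, C' =1 C}.
  by move=> j js; rewrite /C'; case: eqP js si => // ->->.
rewrite PAB -muleA.
have := iA (i :: s) C'; rewrite big_cons {2}/C' eqxx/= si us.
rewrite (eq_big_seq (fun j => P (Y j @^-1` C j))) => [iAs | j /CE ->//].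
rewrite -iAs//; last by move=> j; rewrite /= inE => /orP[/eqP->//|/sD[]].
congr (P _); rewrite !bigcap_seq big_cons {1}/C' eqxx setIA; congr (_ `&` _).
by apply: eq_big_seq => j /CE ->.
Qed.

Lemma indep_of_bigcup (D : set I) (A : nat -> set T) :
  trivIset setT A -> (forall v, indep_of D (A v)) ->
  indep_of D (\bigcup_v A v).
Proof.
move=> tA iA; have mA v : measurable (A v) by case: (iA v).
split=> [|s B us sD]; first exact: bigcup_measurable.
have mC := measurable_cylinder s B.
have mAC v : measurable (A v `&` \bigcap_(i in [set` s]) Y i @^-1` B i).
  exact: measurableI.
rewrite setI_bigcupl measure_semi_bigcup//; last 2 first.
- exact/trivIset_setIr.
- exact: bigcup_measurable.
rewrite measure_semi_bigcup//; last exact: bigcup_measurable.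
have -> : (\prod_(i <- s) P (Y i @^-1` B i) =
   (\prod_(i <- s) fine (P (Y i @^-1` B i)))%:E)%E.
  rewrite -prodEFin; apply: eq_bigr => i _; rewrite fineK//.
  exact/fin_num_measure/measurable_rv_preimage.
rewrite muleC -nneseriesZl//; apply: eq_eseriesr => v _.
have [_ iAv] := iA v; apply: etrans (iAv s B us sD) _; rewrite muleC; congr (_ * _)%E.
rewrite -prodEFin; apply: eq_bigr => i _; rewrite fineK//.
exact/fin_num_measure/measurable_rv_preimage.
Qed.

(** Conditioning on the value of an integer-valued variable; this
    replaces integration against laws by countable unions of events. *)
Lemma preimage_bigcup_eq (Z : T -> nat) (A : set T) :
  A = \bigcup_v (A `&` Z @^-1` [set v]).
Proof.
apply/seteqP; split=> [w Aw|w [v _ []]//].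
by exists (Z w).
Qed.

Lemma trivIset_fibers (Z : T -> nat) (A : set T) :
  trivIset setT (fun v => A `&` Z @^-1` [set v]).
Proof. by move=> u v _ _ [w [[_ <-] [_ <-]]]. Qed.

(** By induction on [s]: condition on the value of the first variable,
    absorb it into the event with [indep_of_setI], and let [C] absorb that
    value. Allowing arbitrary sets of sequences covers sums and maxima at
    once. *)
Lemma indep_of_map (D D' : set I) (A : set T) (s : seq I) (C : set (seq nat)) :
  uniq s -> [set` s] `<=` D -> D' `<=` D `\` [set` s] -> indep_of D A ->
  indep_of D' (A `&` [set w | C [seq Y i w | i <- s]]).
Proof.
elim: s D A C => [|i s IHs] D A C /=; rewrite ?set_nil ?setD0.
  move=> _ _ D'D iA; have [C0|C0] := pselect (C [::]).
    rewrite (_ : [set _ | _] = setT) ?setIT; first exact: indep_of_subset iA.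
    by apply/seteqP; split.
  rewrite (_ : [set _ | _] = set0) ?setI0; last by apply/seteqP; split.
  by split=> // s B _ _; rewrite set0I measure0 mul0e.
move=> /andP[si us] sD D'D iA.
rewrite [X in indep_of _ X](preimage_bigcup_eq (Y i)).
apply: indep_of_bigcup => [|v]; first exact: trivIset_fibers.
have -> : A `&` [set w | C (Y i w :: [seq Y j w | j <- s])] `&`
     Y i @^-1` [set v] =
   (A `&` Y i @^-1` [set v]) `&`
     [set w | (fun l => C (v :: l)) [seq Y j w | j <- s]].
  by apply/seteqP; split=> w /= [[Aw]]; [move=> Cw Yw|move=> Yw Cw]; subst v.
apply: (IHs (D `\ i) _ (fun l => C (v :: l))) => //.
- move=> j js; split; first by apply: sD; rewrite /= inE js orbT.
  by move=> /= ji; move: si js; rewrite ji /= => /negP.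
- move=> j /D'D[Dj js]; split; first split=> //.
    by move=> /= ji; apply: js; rewrite /= ji mem_head.
  by move=> /= js'; apply: js; rewrite /= inE js' orbT.
- by apply: indep_of_setI => //; apply: sD; rewrite /= mem_head.
Qed.

Lemma measurable_map (s : seq I) (C : set (seq nat)) :
  measurable [set w | C [seq Y i w | i <- s]].
Proof.
elim: s C => [|i s IHs] C /=.
  have [C0|C0] := pselect (C [::]).
    by rewrite (_ : [set _ | _] = setT)//; apply/seteqP; split.
  by rewrite (_ : [set _ | _] = set0)//; apply/seteqP; split.
rewrite [X in measurable X](preimage_bigcup_eq (Y i)).
apply: bigcup_measurable => v _.
have -> : [set w | C (Y i w :: [seq Y j w | j <- s])] `&`
     Y i @^-1` [set v] =
   (Y i @^-1` [set v]) `&`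
     [set w | (fun l => C (v :: l)) [seq Y j w | j <- s]].
  by apply/seteqP; split=> w /= []; [move=> Cw Yw|move=> Yw Cw]; subst v.
apply: measurableI; first exact: measurable_rv_preimage.
exact: (IHs (fun l => C (v :: l))).
Qed.

(** Same induction as [indep_of_map]: expanding both [A] and [setT] over
    the values of the first variable gives the same series, up to the factor
    [P A]. *)
Lemma indep_of_prob_map (D : set I) (A : set T) (s : seq I)
    (C : set (seq nat)) :
  indep_of D setT -> indep_of D A -> uniq s -> [set` s] `<=` D ->
  P (A `&` [set w | C [seq Y i w | i <- s]]) =
  (P A * P [set w | C [seq Y i w | i <- s]])%E.
Proof.
elim: s D A C => [|i s IHs] D A C iT iA /=.
  move=> _ _; have [C0|C0] := pselect (C [::]).
    rewrite (_ : [set _ | _] = setT) ?setIT ?probability_setT ?mule1//.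
    by apply/seteqP; split.
  rewrite (_ : [set _ | _] = set0) ?setI0 ?measure0 ?mule0//.
  by apply/seteqP; split.
move=> /andP[si us] sD.
have Di : D i by apply: sD; rewrite /= mem_head.
have sDi : [set` s] `<=` D `\ i.
  move=> j js; split; first by apply: sD; rewrite /= inE js orbT.
  by move=> /= ji; move: si js; rewrite ji /= => /negP.
have iTi : indep_of (D `\ i) setT by apply: indep_of_subset iT => j [].
have fib A' v : indep_of D A' -> P (A' `&` [set w | C (Y i w :: [seq Y j w | j <- s])] `&`
     Y i @^-1` [set v]) = (P A' * (P (Y i @^-1` [set v]) *
      P [set w | C (v :: [seq Y j w | j <- s])]))%E.
  move=> iA'.
  have -> : A' `&` [set w | C (Y i w :: [seq Y j w | j <- s])] `&`
     Y i @^-1` [set v] =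
   (A' `&` Y i @^-1` [set v]) `&`
     [set w | (fun l => C (v :: l)) [seq Y j w | j <- s]].
    by apply/seteqP; split=> w /= [[Aw]]; [move=> Cw Yw|move=> Yw Cw]; subst v.
  rewrite (IHs (D `\ i) _ (fun l => C (v :: l)))//; last exact: indep_of_setI.
  rewrite muleA; congr (_ * _)%E; case: iA' => _ /(_ [:: i] (fun=> [set v])).
  by rewrite set_cons1 bigcap_set1 big_seq1 => -> // j ->.
have sum A' : indep_of D A' -> P (A' `&` [set w | C (Y i w :: [seq Y j w | j <- s])])
  = (P A' * (\sum_(0 <= v <oo) (P (Y i @^-1` [set v]) *
      P [set w | C (v :: [seq Y j w | j <- s])])))%E.
  move=> iA'; have mA' : measurable A' by case: iA'.
  rewrite [X in P X](preimage_bigcup_eq (Y i)) measure_semi_bigcup.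
  - rewrite (eq_eseriesr (fun v _ => fib A' v iA')) -(fineK (fin_num_measure P _ mA')).
    by rewrite nneseriesZl// => v _; rewrite mule_ge0.
  - move=> v; apply: measurableI; last exact: measurable_rv_preimage.
    apply: measurableI => //; exact: (measurable_map (i :: s)).
  - exact: trivIset_fibers.
  - rewrite -preimage_bigcup_eq; apply: measurableI => //.
    exact: (measurable_map (i :: s)).
by rewrite sum// -[in RHS](setTI [set w | _]) (sum setT)// probability_setT mul1e.
Qed.

End independence.

Section reindexing.
Context d (T : measurableType d) (R : realType) (P : probability T R).
Context (I J : choiceType) (Y : I -> {RV P >-> nat}).

(** Used to view one generation of the process as a plain sequence. *)
Lemma indep_of_reindex (f : J -> I) (D : set I) (A : set T) :
  injective f -> (forall j, D (f j)) ->
  indep_of Y D A -> indep_of (fun j => Y (f j)) setT A.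
Proof.
move=> f_inj fD [mA iA]; split=> // s B us _.
pose B' i := [set v | forall j, f j = i -> B j v].
have B'E j : B' (f j) = B j.
  by apply/seteqP; split=> v /=; [exact|move=> Bjv k /f_inj->].
have := iA [seq f j | j <- s] B'; rewrite map_inj_uniq// us => /(_ isT).
rewrite big_map; under eq_bigr do rewrite B'E.
move=> <-; last by move=> i /= /mapP[j _ ->].
congr (P (_ `&` _)); apply/seteqP; split=> w /= h.
  by move=> i /= /mapP[j js ->]; rewrite B'E; exact: h.
by move=> j /= js; have := h (f j); rewrite /= B'E; apply; exact: map_f.
Qed.

Lemma indep_of_family (D : set I) :
  independent_family D Y -> indep_of Y D setT.
Proof.
move=> iY; split=> // s B us sD.
have mB i : i \in [fset x in s]%fset -> measurable (B i) by [].
have := iY [fset x in s]%fset B; rewrite setTI probability_setT mul1e.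
have -> : [set` [fset x in s]%fset] = [set` s].
  by apply/seteqP; split=> i /=; rewrite !inE.
move=> /(_ sD mB) ->; apply: perm_big; apply: uniq_perm => //.
by move=> i; rewrite inE.
Qed.

End reindexing.

(** * Real-valued probabilities and tails *)

Section real_probability.
Context d (T : measurableType d) (R : realType) (P : probability T R).
Implicit Types A B : set T.

Definition prob A : R := fine (P A).

Lemma probE A : measurable A -> P A = (prob A)%:E.
Proof. by move=> mA; rewrite /prob fineK// fin_num_measure. Qed.

Lemma prob_ge0 A : 0 <= prob A.
Proof. by rewrite /prob fine_ge0. Qed.

Lemma prob_le1 A : measurable A -> prob A <= 1.
Proof. by move=> mA; rewrite -lee_fin -probE// probability_le1. Qed.

Lemma prob_setT : prob setT = 1.
Proof. by rewrite /prob probability_setT. Qed.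

Lemma prob_set0 : prob set0 = 0.
Proof. by rewrite /prob measure0. Qed.

Lemma le_prob A B : measurable A -> measurable B -> A `<=` B ->
  prob A <= prob B.
Proof.
by move=> mA mB AB; rewrite -lee_fin -!probE// le_measure ?inE.
Qed.

Lemma prob_setU A B : measurable A -> measurable B -> A `&` B = set0 ->
  prob (A `|` B) = prob A + prob B.
Proof.
move=> mA mB AB; apply: EFin_inj; rewrite EFinD -!probE ?measureU//.
exact: measurableU.
Qed.

Lemma prob_setU_le A B : measurable A -> measurable B ->
  prob (A `|` B) <= prob A + prob B.
Proof.
move=> mA mB; rewrite -lee_fin EFinD -!probE ?measureU2//.
exact: measurableU.
Qed.

Lemma prob_setID A B : measurable A -> measurable B ->
  prob A = prob (A `&` B) + prob (A `&` ~` B).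
Proof.
move=> mA mB; rewrite -prob_setU; first by rewrite -setIUr setUv setIT.
- exact: measurableI.
- by apply: measurableI => //; exact: measurableC.
- by rewrite setIACA setICr setI0.
Qed.

Lemma measurable_rv_set (Z : {RV P >-> nat}) (C : set nat) :
  measurable [set w | C (Z w)].
Proof. exact: (measurable_rv_preimage Z C). Qed.

(** The finite sums produced here make all estimates of tails
    elementary, with no series involved. *)
Lemma prob_fibers (Z : {RV P >-> nat}) A n : measurable A ->
  prob (A `&` [set w | (Z w < n)%N]) =
  \sum_(0 <= v < n) prob (A `&` Z @^-1` [set v]).
Proof.
move=> mA; elim: n => [|n IHn].
  rewrite big_nil (_ : [set _ | _] = set0) ?setI0 ?prob_set0//.
  by apply/seteqP; split.
rewrite big_nat_recr//= -IHn -prob_setU.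
- congr prob; rewrite -setIUr; congr (_ `&` _).
  apply/seteqP; split=> w /=.
    by rewrite ltnS leq_eqVlt => /orP[/eqP|]; [right|left].
  by case=> [/ltnW|->].
- exact/measurableI/(measurable_rv_set Z (fun v => (v < n)%N)).
- exact/measurableI/measurable_rv_preimage.
- by apply/seteqP; split=> // w /= [[_ +] [_ Zn]]; rewrite Zn ltnn.
Qed.

Lemma prob_fibersT (Z : {RV P >-> nat}) n :
  prob [set w | (Z w < n)%N] = \sum_(0 <= v < n) prob (Z @^-1` [set v]).
Proof.
rewrite -[LHS](congr1 prob (setTI _)) prob_fibers//.
by apply: eq_bigr => v _; rewrite setTI.
Qed.

Lemma tailE (Z : T -> nat) (x : R) :
  tail P (toR R Z) x = prob [set w | x < (Z w)%:R].
Proof. by []. Qed.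

Lemma tail_ge0 (Y : T -> R) x : 0 <= tail P Y x.
Proof. exact: prob_ge0. Qed.

Lemma tail_le1 (Z : {RV P >-> nat}) (x : R) : tail P (toR R Z) x <= 1.
Proof. exact/prob_le1/(measurable_rv_set Z (fun v => x < v%:R)). Qed.

Lemma tail_nonincreasing (Z : {RV P >-> nat}) x y : x <= y ->
  tail P (toR R Z) y <= tail P (toR R Z) x.
Proof.
move=> xy; apply: le_prob.
- exact: (measurable_rv_set Z (fun v => y < v%:R)).
- exact: (measurable_rv_set Z (fun v => x < v%:R)).
- by move=> w /=; apply: le_lt_trans.
Qed.

Lemma prob_le_tail (Z : {RV P >-> nat}) (x : R) :
  prob [set w | (Z w)%:R <= x] = 1 - tail P (toR R Z) x.
Proof.
have m1 := measurable_rv_set Z (fun v => v%:R <= x).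
have m2 := measurable_rv_set Z (fun v => x < v%:R).
rewrite -[X in X - _]prob_setT -[X in prob X - _](_ : [set w | (Z w)%:R <= x] `|`
  [set w | x < (Z w)%:R] = setT).
  rewrite prob_setU//; first by rewrite addrK.
  by apply/seteqP; split=> // w /= [Zx /lt_geF]; rewrite Zx.
by apply/seteqP; split=> w //= _; case: leP; [left|right].
Qed.

End real_probability.

(** * Sums of independent random variables *)

Section doubling.
Context (R : realType) (F : R -> R) (q : nat).
Hypothesis F_dec : forall x y, x <= y -> F y <= F x.
Hypothesis F_doubling : forall x, 0 < x -> F x <= 2 ^+ q * F (2 * x).

Lemma doubling_iter x (j : nat) : 0 < x ->
  F x <= (2 ^+ j) ^+ q * F (2 ^+ j * x).
Proof.
move=> x0; elim: j => [|j IHj]; first by rewrite !expr1n expr0 !mul1r.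
apply: (le_trans IHj); rewrite exprS exprMn -mulrA mulrCA.
rewrite ler_wpM2l ?exprn_ge0// -mulrA F_doubling//.
by rewrite mulr_gt0// exprn_gt0.
Qed.

(** A power bound on the decay of [F], with an exponent that is far from
    optimal; the factor 2 in [2 * l] is lost in rounding [l] up to a power of
    two. *)
Lemma doubling_scale x l : (forall x, 0 <= F x) -> 0 < x -> 1 <= l ->
  F x <= (2 * l) ^+ q * F (l * x).
Proof.
move=> F0 x0 l1.
have [j [lj jl]] : exists j, l <= 2 ^+ j /\ 2 ^+ j <= 2 * l.
  have ex : exists j, l <= 2 ^+ j.
    exists (Num.truncn l); apply: (le_trans (ltW (truncnS_gt _))).
    by rewrite -natrX ler_nat ltn_expl.
  case: (ex_minnP ex) => -[|j] lj min; [exists 0%N|exists j.+1]; split=> //.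
    by rewrite expr0; lra.
  have := min j; rewrite ltnn; case: (lerP l (2 ^+ j)) => [_ /(_ isT)//|lj2 _].
  by rewrite exprS ler_wpM2l// ltW.
apply: (le_trans (doubling_iter j x0)).
apply: ler_pM; rewrite ?exprn_ge0//.
  by apply: lerXn2r; rewrite ?nnegrE ?exprn_ge0//; lra.
by apply: F_dec; rewrite ler_wpM2r// ltW.
Qed.
End doubling.

(** From [1 / expR t = expR (- t) >= 1 - t]; the bound 1/2 makes
    [(1 + t + 2 t^2) (1 - t) = 1 + t^2 (1 - 2 t) >= 1]. *)
Lemma expR_le_quadratic (R : realType) (t : R) : t <= 1 / 2 ->
  expR t <= 1 + t + 2 * t ^+ 2.
Proof.
move=> t2; have := expR_ge1Dx (- t); have := expR_gt0 t.
have : expR t * expR (- t) = 1 by rewrite expRN divff// gt_eqF// expR_gt0.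
have : 0 <= t ^+ 2 by exact: sqr_ge0.
rewrite -[expR (- t)]/(id _); move: (expR (- t)) => e /=; nra.
Qed.

Lemma iota1S (k : nat) : iota 1 k.+1 = rcons (iota 1 k) k.+1.
Proof. by rewrite -[in LHS](addn1 k) iotaD add1n cats1. Qed.

Section partial_sums.
Context d (T : measurableType d) (R : realType) (P : probability T R).
Context (W : nat -> {RV P >-> nat}).

Definition psum (k : nat) : T -> nat :=
  fun w => (\sum_(1 <= i < k.+1) W i w)%N.

Lemma psumE k w : psum k w = sumn [seq W i w | i <- iota 1 k].
Proof. by rewrite /psum sumnE big_map /index_iota subSS subn0. Qed.

Lemma psum0 w : psum 0 w = 0%N.
Proof. by rewrite /psum big_geq. Qed.

Lemma psumS k w : psum k.+1 w = (psum k w + W k.+1 w)%N.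
Proof. by rewrite /psum big_nat_recr. Qed.

Lemma measurable_psum k : measurable_fun setT (psum k).
Proof.
move=> _ B _; rewrite setTI.
have -> : psum k @^-1` B = [set w | (fun l => B (sumn l)) [seq W i w | i <- iota 1 k]].
  by apply/seteqP; split=> w /=; rewrite psumE.
exact: (measurable_map W (iota 1 k) (fun l => B (sumn l))).
Qed.

HB.instance Definition _ k :=
  isMeasurableFun.Build _ _ _ _ (psum k) (measurable_psum k).

End partial_sums.

Section independent_sums.
Context d (T : measurableType d) (R : realType) (P : probability T R).
Context (W : nat -> {RV P >-> nat}) (xi : {RV P >-> nat}).
Hypothesis indepW : indep_of W setT setT.
Hypothesis Wxi : forall i (B : set nat), (0 < i)%N ->
  prob P (W i @^-1` B) = prob P (xi @^-1` B).

Let p (v : nat) : R := prob P (xi @^-1` [set v]).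
Let F (x : R) : R := tail P (toR R xi) x.

Lemma prob_indep_map (j : nat) (s : seq nat) (B : set nat) (C : set (seq nat)) :
  j \notin s -> uniq s ->
  prob P (W j @^-1` B `&` [set w | C [seq W i w | i <- s]]) =
  prob P (W j @^-1` B) * prob P [set w | C [seq W i w | i <- s]].
Proof.
move=> js us; apply: EFin_inj; rewrite EFinM -!probE.
- have iT : indep_of W (setT `\ j) setT by exact: indep_of_subset indepW.
  apply: (indep_of_prob_map C iT) => //.
    by rewrite -[X in indep_of _ _ X]setTI; exact: indep_of_setI.
  by move=> i /= i_s; split=> // ij; move: js; rewrite -ij i_s.
- exact: measurable_map.
- exact: measurable_rv_preimage.
- by apply: measurableI; [exact: measurable_rv_preimage|exact: measurable_map].
Qed.

(** A Chernoff bound, by conditioning on the last summand. It serves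
    for both signs of [s]: truncation at [h] keeps the exponential moment
    finite when [s > 0], and costs nothing when [s < 0], since a sum that is
    at most [x] only has summands that are at most [x]. *)
Lemma prob_psum_bounded_le (k h : nat) (s z : R) :
  prob P [set w | z <= s * (psum W k w)%:R /\
                  all (fun v => v < h)%N [seq W i w | i <- iota 1 k]]
  <= expR (- z) * (\sum_(0 <= v < h) p v * expR (s * v%:R)) ^+ k.
Proof.
pose C z : set (seq nat) := fun l => z <= s * (sumn l)%:R /\ all (fun v => v < h)%N l.
have CE k' z' : [set w | z' <= s * (psum W k' w)%:R /\
      all (fun v => v < h)%N [seq W i w | i <- iota 1 k']] =
    [set w | C z' [seq W i w | i <- iota 1 k']].
  by apply/seteqP; split=> w /=; rewrite /C psumE.
rewrite CE; elim: k z => [|k IHk] z.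
  rewrite expr0 mulr1 /= /C /=.
  have [z0|z0] := leP z 0.
    apply: (@le_trans _ _ 1); last by rewrite -expR0 ler_expR; lra.
    exact/prob_le1/(measurable_map W [::] (C z)).
  rewrite (_ : [set _ | _] = set0) ?prob_set0 ?expR_ge0//.
  by apply/seteqP; split=> // w /= [+ _]; rewrite mulr0 leNgt z0.
have CS w : C z [seq W i w | i <- iota 1 k.+1] <->
    C (z - s * (W k.+1 w)%:R) [seq W i w | i <- iota 1 k] /\ (W k.+1 w < h)%N.
  rewrite /C iota1S map_rcons all_rcons sumn_rcons natrD mulrDr lerBlDr.
  by split=> [[-> /andP[-> ->]]|[[-> ->] ->]].
set A := [set w | _].
have mA : measurable A by exact: measurable_map.
have AE : A = A `&` [set w | (W k.+1 w < h)%N].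
  by apply/seteqP; split=> [w Aw|w []//]; split=> //; have /CS[] := Aw.
rewrite AE prob_fibers// exprS mulrCA mulr_suml big_nat_cond [leRHS]big_nat_cond.
apply: ler_sum => v /andP[/andP[_ vh] _].
have -> : A `&` W k.+1 @^-1` [set v] = W k.+1 @^-1` [set v] `&`
    [set w | C (z - s * v%:R) [seq W i w | i <- iota 1 k]].
  apply/seteqP; split=> w [] /=.
    by move=> /CS[Cw _] Wv; subst v.
  by move=> Wv Cw; subst v; split=> //; apply/CS.
rewrite prob_indep_map ?iota_uniq//; last first.
  by rewrite mem_iota add1n ltnn andbF.
rewrite Wxi// -/(p v) -mulrA ler_wpM2l ?prob_ge0//.
apply: (le_trans (IHk _)); rewrite mulrA -expRD ler_wpM2r//.
  by rewrite exprn_ge0// sumr_ge0// => u _; rewrite mulr_ge0 ?prob_ge0 ?expR_ge0.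
by rewrite ler_expR; lra.
Qed.

Lemma prob_has_le (s : seq nat) (h : nat) : all (fun i => 0 < i)%N s ->
  prob P [set w | ~~ all (fun v => v < h)%N [seq W i w | i <- s]] <=
  (size s)%:R * prob P [set w | (h <= xi w)%N].
Proof.
elim: s => [_|i s IHs] /=.
  by rewrite mul0r (_ : [set _ | _] = set0) ?prob_set0//; apply/seteqP; split.
move=> /andP[i0 s0].
rewrite (_ : [set _ | _] = W i @^-1` [set v | (h <= v)%N] `|`
   [set w | ~~ all (fun v => v < h)%N [seq W i w | i <- s]]); last first.
  apply/seteqP; split=> w /=; rewrite negb_and -leqNgt.
    by move=> /orP.
  by move=> h'; apply/orP.
apply: (le_trans (prob_setU_le _ _ _)).
- exact: measurable_rv_preimage.
- exact: (measurable_map W s (fun l => ~~ all (fun v => v < h)%N l)).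
by rewrite Wxi// -natr1 mulrDl mul1r addrC lerD2r IHs.
Qed.

End independent_sums.

(** * Large deviations of sums with tails of bounded decay *)

Section large_deviations.
Context d (T : measurableType d) (R : realType) (P : probability T R).
Context (W : nat -> {RV P >-> nat}) (xi : {RV P >-> nat}).
Hypothesis indepW : indep_of W setT setT.
Hypothesis Wxi : forall i (B : set nat), (0 < i)%N ->
  prob P (W i @^-1` B) = prob P (xi @^-1` B).

Let p (v : nat) : R := prob P (xi @^-1` [set v]).
Let F (x : R) : R := tail P (toR R xi) x.
Variable m : R.
Hypothesis mean_le : forall n, \sum_(0 <= v < n) p v * v%:R <= m.

Lemma sum_pmf_le1 n : \sum_(0 <= v < n) p v <= 1.
Proof.
rewrite -prob_fibersT.
exact/prob_le1/(measurable_rv_set xi (fun v => (v < n)%N)).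
Qed.

(** Below [eta / (2 s)] the exponential is linear up to a factor
    [1 + eta], so that only the mean enters; above, it is bounded by its
    largest value, at the cost of the tail at [eta / (2 s)]. *)
Lemma mgf_bounded_le (s eta h : R) (H : nat) :
  0 < s -> 0 < eta -> eta <= 1 -> (forall v, (v < H)%N -> v%:R <= h) ->
  \sum_(0 <= v < H) p v * expR (s * v%:R) <=
  1 + (1 + eta) * s * m + F (eta / (2 * s)) * expR (s * h).
Proof.
move=> s0 eta0 eta1 Hh; set x0 := eta / (2 * s).
pose A := [set w | x0 < (xi w)%:R].
have mA : measurable A by exact: (measurable_rv_set xi (fun v => x0 < v%:R)).
pose p' v := prob P (A `&` xi @^-1` [set v]).
have step v : (v < H)%N -> p v * expR (s * v%:R) <=
    p v + (1 + eta) * s * (p v * v%:R) + p' v * expR (s * h).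
  move=> vH; have pv0 : 0 <= p v by exact: prob_ge0.
  have p'v0 : 0 <= p' v by exact: prob_ge0.
  have [vx|xv] := leP v%:R x0.
    have sv : s * v%:R <= eta / 2.
      by move: vx; rewrite /x0 ler_pdivlMr ?mulr_gt0//; lra.
    have sv0 : 0 <= s * v%:R by rewrite mulr_ge0// ltW.
    have e1 : expR (s * v%:R) <= 1 + (1 + eta) * (s * v%:R).
      by apply: (le_trans (expR_le_quadratic _)); [lra|nra].
    have := ler_wpM2l pv0 e1.
    have : 0 <= p' v * expR (s * h) by rewrite mulr_ge0 ?expR_ge0.
    by lra.
  have -> : p' v = p v.
    by congr prob; apply/seteqP; split=> w /=; [case|move=> Zv; subst v].
  have : p v * expR (s * v%:R) <= p v * expR (s * h).
    by rewrite ler_wpM2l// ler_expR ler_wpM2l ?Hh// ltW.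
  have : 0 <= (1 + eta) * s * (p v * v%:R).
    by apply: mulr_ge0; apply: mulr_ge0 => //; lra.
  by lra.
apply: (@le_trans _ _ (\sum_(0 <= v < H)
   (p v + (1 + eta) * s * (p v * v%:R) + p' v * expR (s * h)))).
  rewrite big_nat_cond [leRHS]big_nat_cond.
  by apply: ler_sum => v /andP[/andP[_ vH] _]; exact: step.
rewrite !big_split/= -mulr_sumr -mulr_suml -prob_fibers//.
apply: lerD; first apply: lerD; first exact: sum_pmf_le1.
  by rewrite ler_wpM2l// mulr_ge0//; lra.
rewrite ler_wpM2r ?expR_ge0//; apply: le_prob => //.
  by apply: measurableI => //; exact: (measurable_rv_set xi (fun v => (v < H)%N)).
Qed.

Variable q : nat.
Hypothesis F_gt0 : forall x, 0 < x -> 0 < F x.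
Hypothesis F_doubling : forall x, 0 < x -> F x <= 2 ^+ q.+1 * F (2 * x).

(** The uniform one-big-jump bound. Either some summand exceeds [y / 4],
    or the truncated sum deviates by [y]. Let [u = k F(y)] be the target and
    [L = - ln u]. In the exponent of the Chernoff bound with
    [s = 2 L / y], the deviation contributes [- 2 L], half of which is lost to
    the linearization error [eta k m <= y / 2], and the large summands
    contribute at most [k F(eta y / (4 L)) expR (L / 2)]. As [F] decays at most
    like a power, this is a power of [L] times [u expR (L / 2) = expR (- L / 2)],
    hence bounded, and the total is [O(u)]. *)
Lemma tail_psum_le (eta : R) : 0 < eta -> eta <= 1 ->
  exists2 C, 0 <= C & forall (k : nat) y, 0 < y -> eta * (k%:R * m) <= y / 2 ->
  tail P (toR R (psum W k)) (k%:R * m + y) <= C * (k%:R * F y).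
Proof.
move=> eta0 eta1.
have F0 x : 0 <= F x by exact: tail_ge0.
have F_dec x y : x <= y -> F y <= F x by exact: tail_nonincreasing.
pose C1 : R := (8 / eta) ^+ q.+1 * (2 ^+ q.+1 * (q.+1)`!%:R).
have C10 : 0 <= C1.
  by rewrite /C1 !mulr_ge0 ?exprn_ge0 ?divr_ge0 // ltW.
exists (8 ^+ q.+1 + expR C1 + expR 1).
  by rewrite !addr_ge0 ?expR_ge0 ?exprn_ge0.
move=> k y y0 etay.
have mS := measurable_rv_set (psum W k : {RV P >-> nat}) (fun v => k%:R * m + y < v%:R).
have m0 : 0 <= m by have := mean_le 0; rewrite big_geq.
have [->|k0] := posnP k.
  rewrite !mul0r add0r mulr0 tailE (_ : [set _ | _] = set0) ?prob_set0//.
  by apply/seteqP; split=> // w /=; rewrite psum0 ltNge (ltW y0).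
set u := k%:R * F y.
have u0 : 0 < u by rewrite mulr_gt0 ?ltr0n ?F_gt0.
(* For [u > expR (-1)] the trivial bound 1 is good enough; otherwise [L >= 1],
   which [doubling_scale] needs below. *)
have [u1|u1] := ltP (expR (-1)) u.
  apply: (le_trans (tail_le1 _ _)).
  apply: (@le_trans _ _ (expR 1 * u)).
    by rewrite -[leLHS](expRxMexpNx_1 1) ler_wpM2l ?expR_ge0// ltW.
  by rewrite ler_wpM2r ?(ltW u0)// lerDr addr_ge0 ?expR_ge0 ?exprn_ge0.
set L := - ln u.
have uL : u = expR (- L) by rewrite opprK lnK.
have L1 : 1 <= L by move: u1; rewrite uL ler_expR; lra.
(* [s] is kept opaque, so that rewriting does not see through it. *)
have [s sE] : exists s, s = 2 * L / y by exists (2 * L / y).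
have s0 : 0 < s by rewrite sE divr_gt0//; lra.
have sy : s * y = 2 * L by rewrite sE divfK// gt_eqF.
pose h := y / 4.
pose H := (Num.truncn h).+1.
have h0 : 0 <= h by rewrite /h; lra.
have Hh v : (v < H)%N = (v%:R <= h) by rewrite ltnS truncn_ge_nat.
have sh : s * h = L / 2 by rewrite /h mulrA sy; lra.
have Fh0 : F (eta / (2 * s)) <= (8 * L / eta) ^+ q.+1 * F y.
  have -> : 8 * L / eta = 2 * (4 * L / eta) by lra.
  have -> : y = (4 * L / eta) * (eta / (2 * s)).
    by rewrite sE; field; rewrite !gt_eqF//; lra.
  apply: doubling_scale => //.
    by rewrite divr_gt0// mulr_gt0.
  by rewrite ler_pdivlMr//; lra.
set Mg := \sum_(0 <= v < H) p v * expR (s * v%:R).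
have Mg0 : 0 <= Mg.
  by rewrite sumr_ge0// => v _; rewrite mulr_ge0 ?prob_ge0 ?expR_ge0.
have MgE : Mg <= expR ((1 + eta) * s * m + F (eta / (2 * s)) * expR (s * h)).
  apply: le_trans (expR_ge1Dx _); rewrite addrA.
  by apply: mgf_bounded_le => // v; rewrite Hh.
(* The power of [L] is absorbed by [expR (L / 2) >= (L / 2)^(q+1) / (q+1)!]. *)
have kF : k%:R * (F (eta / (2 * s)) * expR (s * h)) <= C1.
  apply: (@le_trans _ _ (((8 * L / eta) ^+ q.+1 * expR (- (L / 2))))).
    rewrite mulrA sh.
    have -> : expR (- (L / 2)) = u * expR (L / 2).
      by rewrite uL -expRD; congr expR; lra.
    rewrite mulrA. rewrite ler_wpM2r ?expR_ge0// /u mulrCA ler_wpM2l//.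
  have -> : 8 * L / eta = (8 / eta) * L by lra.
  rewrite exprMn /C1 -mulrA ler_wpM2l ?exprn_ge0 ?divr_ge0 ?(ltW eta0)//.
  have L20 : 0 <= L / 2 by lra.
  have := expR_ge1Dxn q L20.
  rewrite expRN ler_pdivrMr ?expR_gt0//.
  set E := expR _ => HE.
  have : (L / 2) ^+ q.+1 / (q.+1)`!%:R <= E by lra.
  rewrite ler_pdivrMr ?ltr0n ?fact_gt0// => {}HE.
  have -> : L ^+ q.+1 = 2 ^+ q.+1 * (L / 2) ^+ q.+1.
    by rewrite -exprMn; congr (_ ^+ _); lra.
  by rewrite -mulrA ler_wpM2l ?exprn_ge0// [leRHS]mulrC.
pose al (l : seq nat) := all (fun v => v < H)%N l.
pose A1 := [set w | ~~ al [seq W i w | i <- iota 1 k]].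
pose z := s * (k%:R * m + y).
pose A2 := [set w | z <= s * (psum W k w)%:R /\
                    al [seq W i w | i <- iota 1 k]].
have mA1 : measurable A1 by exact: (measurable_map W (iota 1 k) (fun l => ~~ al l)).
have mA2 : measurable A2.
  have -> : A2 = [set w | (fun l => z <= s * (sumn l)%:R /\ al l)
                            [seq W i w | i <- iota 1 k]].
    by apply/seteqP; split=> w; rewrite /A2 /= psumE.
  exact: (measurable_map W (iota 1 k)
    (fun l => z <= s * (sumn l)%:R /\ al l)).
have sub : prob P [set w | k%:R * m + y < (psum W k w)%:R] <= prob P A1 + prob P A2.
  apply: le_trans (prob_setU_le _ mA1 mA2).
  apply: le_prob; [exact: mS|exact: measurableU|].
  move=> w /= Sw; have [aw|aw] := boolP (al [seq W i w | i <- iota 1 k]).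
    by right; split=> //; rewrite ler_wpM2l// ltW.
  by left.
have PA1 : prob P A1 <= 8 ^+ q.+1 * u.
  have iota0 : all (fun i => 0 < i)%N (iota 1 k).
    by apply/allP => i; rewrite mem_iota => /andP[].
  apply: (le_trans (prob_has_le Wxi H iota0)); rewrite size_iota /u mulrCA.
  rewrite ler_wpM2l//; apply: (@le_trans _ _ (F h)).
    apply: le_prob.
    - exact: (measurable_rv_set xi (fun v => (H <= v)%N)).
    - exact: (measurable_rv_set xi (fun v => h < v%:R)).
    - by move=> w /=; rewrite leqNgt Hh -ltNge.
  have -> : y = 4 * h by rewrite /h; lra.
  have -> : 8 = 2 * 4 :> R by lra.
  by apply: doubling_scale => //; rewrite /h; lra.
have PA2 : prob P A2 <= expR C1 * u.
  apply: (le_trans (prob_psum_bounded_le indepW Wxi _ _ _ _)).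
  rewrite -/Mg; apply: (@le_trans _ _ (expR (- (s * (k%:R * m + y))) *
     expR (k%:R * ((1 + eta) * s * m + F (eta / (2 * s)) * expR (s * h))))).
    by rewrite ler_wpM2l ?expR_ge0// expRM_natl lerXn2r// nnegrE expR_ge0.
  rewrite -expRD uL -expRD ler_expR.
  have : s * (eta * (k%:R * m)) <= s * (y / 2) by rewrite ler_wpM2l// ltW.
  by move: sy kF; lra.
rewrite tailE (le_trans sub)//.
rewrite -/u !mulrDl; have : 0 <= expR 1 * u by rewrite mulr_ge0 ?expR_ge0// ltW.
by lra.
Qed.

Hypothesis mean_ge : forall a, a < m ->
  exists n, a <= \sum_(0 <= v < n) p v * v%:R.

(** The exponential moment at [- s] is at most [1 - s a] for small [s],
    because a finite part of the law already has mean greater than [a]. *)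
Lemma prob_psum_le (a : R) : a < m ->
  exists2 s, 0 < s & forall (k : nat) x, 0 <= x ->
    prob P [set w | (psum W k w)%:R <= x] <= expR (s * (x - k%:R * a)).
Proof.
move=> am.
have [M aM] : exists M, (m + a) / 2 <= \sum_(0 <= v < M) p v * v%:R.
  by apply: mean_ge; lra.
(* [D] bounds the squares of the values that are kept; with this [s] the
   quadratic error [2 s^2 D] is half of the gain [s (m - a)]. *)
pose D : R := M%:R ^+ 2 + 1.
have D0 : 0 < D by rewrite /D ltr_wpDl// sqr_ge0.
have [s sE] : exists s, s = (m - a) / (4 * D) by exists ((m - a) / (4 * D)).
have s0 : 0 < s by rewrite sE divr_gt0//; lra.
have sD : s * D = (m - a) / 4.
  by rewrite sE; field; rewrite gt_eqF.
exists s => // k x x0.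
(* Taking [H >= M] keeps the part of the law that produces the mean. *)
pose H := maxn M (Num.truncn x).+1.
have xH v : v%:R <= x -> (v < H)%N.
  by rewrite -truncn_ge_nat// => vx; rewrite /H leq_max ltnS vx orbT.
pose Mg := \sum_(0 <= v < H) p v * expR (- s * v%:R).
have Mg0 : 0 <= Mg.
  by rewrite sumr_ge0// => v _; rewrite mulr_ge0 ?prob_ge0 ?expR_ge0.
have MgE : Mg <= 1 - s * a.
  have MH : (M <= H)%N by rewrite /H leq_maxl.
  rewrite /Mg (big_cat_nat (n := M))//=.
  have := sum_pmf_le1 H; rewrite (big_cat_nat (n := M))//=.
  have h2 : \sum_(M <= v < H) p v * expR (- s * v%:R) <= \sum_(M <= v < H) p v.
    apply: ler_sum => v _; rewrite ler_piMr ?prob_ge0// expR_le1.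
    by rewrite mulNr oppr_le0 mulr_ge0// ltW.
  have h1 : \sum_(0 <= v < M) p v * expR (- s * v%:R) <=
     \sum_(0 <= v < M) (p v - s * (p v * v%:R) + 2 * s ^+ 2 * D * p v).
    rewrite big_nat_cond [leRHS]big_nat_cond.
    apply: ler_sum => v /andP[/andP[_ vM] _].
    have p0 : 0 <= p v by exact: prob_ge0.
    have v0 : 0 <= v%:R :> R by [].
    have e1 : expR (- s * v%:R) <= 1 - s * v%:R + 2 * (s * v%:R) ^+ 2.
      have sv : - s * v%:R <= 1 / 2 by nra.
      by apply: (le_trans (expR_le_quadratic sv)); rewrite mulNr sqrrN; lra.
    have vD : v%:R ^+ 2 <= D.
      have : v%:R ^+ 2 <= M%:R ^+ 2 :> R.
        by rewrite lerXn2r ?nnegrE// ler_nat ltnW.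
      by rewrite /D; lra.
    have svD : 2 * (s * v%:R) ^+ 2 <= 2 * s ^+ 2 * D.
      by rewrite exprMn mulrA ler_wpM2l// mulr_ge0// sqr_ge0.
    have : p v * expR (- s * v%:R) <= p v * (1 - s * v%:R + 2 * s ^+ 2 * D).
      by rewrite ler_wpM2l//; lra.
    by lra.
  rewrite !big_split/= sumrN -!mulr_sumr in h1.
  have pM : 0 <= \sum_(0 <= v < M) p v by rewrite sumr_ge0// => v _; exact: prob_ge0.
  have pM1 := sum_pmf_le1 M.
  have : s * ((m + a) / 2) <= s * \sum_(0 <= v < M) p v * v%:R.
    by rewrite ler_wpM2l// ltW.
  have : 2 * s ^+ 2 * D * \sum_(0 <= v < M) p v <= 2 * s ^+ 2 * D.
    by rewrite ler_piMr// mulr_ge0 ?(ltW D0)// mulr_ge0// sqr_ge0.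
  have sD2 : 2 * s ^+ 2 * D = s * ((m - a) / 2).
    by rewrite expr2 -mulrA -mulrA sD; lra.
  rewrite sD2 in h1 *.
  by lra.
apply: (@le_trans _ _ (expR (- (- s * x)) * Mg ^+ k)).
  apply: le_trans (prob_psum_bounded_le indepW Wxi k H _ _).
  pose Cl l := - s * x <= - s * (sumn l)%:R /\ all (fun v => v < H)%N l.
  apply: le_prob.
  - exact: (measurable_rv_set (psum W k : {RV P >-> nat}) (fun v => v%:R <= x)).
  - rewrite [X in measurable X](_ : _ = [set w | Cl [seq W i w | i <- iota 1 k]]).
      exact: measurable_map.
    by apply/seteqP; split=> w; rewrite /= psumE.
  - move=> w /= Sx; split; first by rewrite !mulNr lerN2 ler_wpM2l// ltW.
    apply/allP => v /mapP[i ii ->]; apply: xH; apply: le_trans Sx.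
    rewrite psumE sumnE big_map ler_nat (big_rem i)//= leq_addr//.
have -> : s * (x - k%:R * a) = - (- s * x) + k%:R * (- (s * a)) by lra.
rewrite expRD ler_wpM2l ?expR_ge0// expRM_natl lerXn2r// ?nnegrE ?expR_ge0//.
by apply: (le_trans MgE); exact: expR_ge1Dx.
Qed.

End large_deviations.

(** * Expectations of integer-valued random variables *)

Section expectations.
Context d (T : measurableType d) (R : realType) (P : probability T R).
Implicit Types Y : {RV P >-> nat}.

Lemma measurable_fun_rv (g : nat -> R) Y (A : set T) :
  measurable A -> measurable_fun A (EFin \o (g \o Y)).
Proof.
move=> mA; apply/measurable_EFinP.
apply: (measurable_funS measurableT) => //.
by apply: (measurableT_comp (f := g)).
Qed.

Lemma integral_rv (g : nat -> R) Y (A : set T) : (forall v, 0 <= g v) ->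
  measurable A ->
  (\int[P]_(w in A) (g (Y w))%:E =
   \sum_(0 <= v <oo) (g v * prob P (A `&` Y @^-1` [set v]))%:E)%E.
Proof.
move=> g0 mA.
have mAY v : measurable (A `&` Y @^-1` [set v]).
  by apply: measurableI => //; exact: measurable_rv_preimage.
rewrite {1}(preimage_bigcup_eq Y A) ge0_integral_bigcup//.
- apply: eq_eseriesr => v _.
  rewrite (eq_integral (cst (g v)%:E)); last by move=> w; rewrite inE => -[_ ->].
  by rewrite integral_cst// EFinM; congr (_ * _)%E; exact: probE.
- rewrite -preimage_bigcup_eq; exact: measurable_fun_rv.
- by move=> w _; rewrite lee_fin.
- exact: trivIset_fibers.
Qed.

Lemma expectation_rv Y :
  ('E_P[toR R Y] = \sum_(0 <= v <oo) (prob P (Y @^-1` [set v]) * v%:R)%:E)%E.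
Proof.
rewrite unlock /toR (@integral_rv (fun v => v%:R))//.
by apply: eq_eseriesr => v _; rewrite setTI mulrC.
Qed.

Lemma expectation_rv_ge0 Y : (0 <= 'E_P[toR R Y])%E.
Proof. by apply: expectation_ge0 => w; rewrite /toR. Qed.

Lemma expectation_rv_fin Y : ('E_P[toR R Y] < +oo)%E ->
  ('E_P[toR R Y] = (fine 'E_P[toR R Y])%:E)%E.
Proof. by move=> Yoo; rewrite fineK// ge0_fin_numE// expectation_rv_ge0. Qed.

Lemma partial_mean_le Y n : ('E_P[toR R Y] < +oo)%E ->
  \sum_(0 <= v < n) prob P (Y @^-1` [set v]) * v%:R <= fine ('E_P[toR R Y])%E.
Proof.
move=> Yoo; rewrite -lee_fin -expectation_rv_fin// expectation_rv -sumEFin.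
by apply: nneseries_lim_ge => v _ _; rewrite lee_fin mulr_ge0 ?prob_ge0.
Qed.

Lemma partial_mean_ge Y a : ('E_P[toR R Y] < +oo)%E ->
  a < fine ('E_P[toR R Y])%E ->
  exists n, a <= \sum_(0 <= v < n) prob P (Y @^-1` [set v]) * v%:R.
Proof.
move=> Yoo aY; apply: contrapT => /forallNP H.
suff : fine ('E_P[toR R Y])%E <= a by rewrite leNgt aY.
rewrite -lee_fin -expectation_rv_fin// expectation_rv.
apply: lime_le.
  by apply: is_cvg_nneseries => v _ _; rewrite lee_fin mulr_ge0 ?prob_ge0.
near=> n; rewrite sumEFin lee_fin ltW// ltNge; exact/negP/H.
Unshelve. all: by end_near. Qed.

Lemma expectation_lty_of_partial Y B :
  (forall n, \sum_(0 <= v < n) prob P (Y @^-1` [set v]) * v%:R <= B) ->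
  ('E_P[toR R Y] < +oo)%E.
Proof.
move=> H; apply: (@le_lt_trans _ _ B%:E); last exact: ltry.
rewrite expectation_rv; apply: lime_le.
  by apply: is_cvg_nneseries => v _ _; rewrite lee_fin mulr_ge0 ?prob_ge0.
by near=> n; rewrite sumEFin lee_fin.
Unshelve. all: by end_near. Qed.

(** Markov's inequality for the moment of order [r]. *)
Lemma tail_powR_le Y (r : R) : 0 <= r ->
  ('E_P[fun w => (toR R Y w `^ r)%R] < +oo)%E ->
  forall x, 0 < x ->
  x `^ r * tail P (toR R Y) x <= fine ('E_P[fun w => (toR R Y w `^ r)%R])%E.
Proof.
move=> r0 Yoo.
have E0 : (0 <= 'E_P[fun w => (toR R Y w `^ r)%R])%E.
  by apply: expectation_ge0 => w; exact: powR_ge0.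
move=> x x0; rewrite -lee_fin fineK ?ge0_fin_numE//.
have mA : measurable [set w | x < (Y w)%:R].
  exact: (measurable_rv_set Y (fun v => x < v%:R)).
rewrite EFinM tailE -probE// -integral_cst// unlock.
set A := [set w | _] in mA *.
have h1 : (\int[P]_(w in A) cst (x `^ r)%:E w <=
    \int[P]_(w in A) (toR R Y w `^ r)%:E)%E.
  apply: ge0_le_integral => //.
  - by move=> w _; rewrite lee_fin powR_ge0.
  - exact: (@measurable_fun_rv (fun v => v%:R `^ r) Y).
  - move=> w /= xw; rewrite lee_fin ge0_ler_powR// ?nnegrE ?ltW//.
    exact: lt_trans xw.
apply: (le_trans h1); apply: ge0_subset_integral => //.
- exact: (@measurable_fun_rv (fun v => v%:R `^ r) Y).
- by move=> w _; rewrite lee_fin powR_ge0.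
Qed.

Lemma tail_markov Y : ('E_P[toR R Y] < +oo)%E ->
  forall x, 0 < x -> x * tail P (toR R Y) x <= fine ('E_P[toR R Y])%E.
Proof.
move=> Yoo x x0; have Y1 : (fun w => (toR R Y w `^ 1)%R) = toR R Y.
  by apply/funext => w; rewrite powRr1// /toR.
by have := @tail_powR_le Y 1 ler01; rewrite Y1 => /(_ Yoo x x0); rewrite powRr1// ltW.
Qed.

Lemma tail_cvg0 Y : ('E_P[toR R Y] < +oo)%E ->
  forall t, 0 < t -> \forall x \near +oo, tail P (toR R Y) x <= t.
Proof.
move=> Yoo t t0; near=> x.
have x0 : 0 < x by near: x; apply: nbhs_pinfty_gt; exact: num_real.
rewrite -(ler_pM2l x0) (le_trans (tail_markov Yoo x0))//.
rewrite -ler_pdivrMr; last exact: t0.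
by near: x; apply: nbhs_pinfty_ge; exact: num_real.
Unshelve. all: by end_near. Qed.

(** An integer [n] satisfies [n <= n `^ r] for [1 <= r]. *)
Lemma expectation_lty_of_powR Y (r : R) : 1 <= r ->
  ('E_P[fun w => (toR R Y w `^ r)%R] < +oo)%E -> ('E_P[toR R Y] < +oo)%E.
Proof.
move=> r1; rewrite unlock => Yoo; apply: le_lt_trans Yoo.
apply: ge0_le_integral => //.
- by move=> w _; rewrite lee_fin.
- exact: (@measurable_fun_rv (fun v => v%:R) Y).
- exact: (@measurable_fun_rv (fun v => v%:R `^ r) Y).
- move=> w _; rewrite lee_fin /toR; case: (Y w) => [|n]; first exact: powR_ge0.
  by rewrite -[leLHS]powRr1// ler_powR// ler1n.
Qed.

End expectations.

Section random_sum_expectation.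
Context d (T : measurableType d) (R : realType) (P : probability T R).
Context (W : nat -> {RV P >-> nat}) (N X : {RV P >-> nat}).
Hypothesis indepN : forall k, indep_of W setT (N @^-1` [set k]).
Hypothesis XE : forall w, X w = (psum W (N w) w + W 0 w)%N.

Lemma integral_indep_of (A : set T) (i : nat) (mu : R) : indep_of W setT A ->
  ('E_P[toR R (W i)] = mu%:E)%E ->
  (\int[P]_(w in A) (toR R (W i) w)%:E = (prob P A * mu)%:E)%E.
Proof.
move=> iA Wmu; have mA : measurable A by case: iA.
rewrite /toR (@integral_rv _ _ _ _ (fun v => v%:R))//.
rewrite EFinM -Wmu expectation_rv -nneseriesZl.
  apply: eq_eseriesr => v _; rewrite -EFinM mulrCA [_%:R * _]mulrC; congr EFin.
  case: iA => _ /(_ [:: i] (fun=> [set v]) isT).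
  rewrite set_cons1 bigcap_set1 big_seq1 => /(_ (fun _ _ => I)).
  rewrite !probE//; first by rewrite -EFinM => -[->]; ring.
  - exact: measurable_rv_preimage.
  - by apply: measurableI => //; exact: measurable_rv_preimage.
by move=> v _; rewrite lee_fin mulr_ge0 ?prob_ge0.
Qed.

(** Wald's identity with immigration, by integrating over the events
    [N = k]. *)
Lemma expectation_random_sum (m b e : R) :
  (forall i, (0 < i)%N -> 'E_P[toR R (W i)] = m%:E)%E ->
  ('E_P[toR R (W 0)] = b%:E)%E -> ('E_P[toR R N] = e%:E)%E ->
  ('E_P[toR R X] = (m * e + b)%:E)%E.
Proof.
move=> Wm Wb Ne.
have m0 : 0 <= m by rewrite -lee_fin -(Wm 1%N)// expectation_rv_ge0.
have b0 : 0 <= b by rewrite -lee_fin -Wb expectation_rv_ge0.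
have mN k : measurable (N @^-1` [set k]) by exact: measurable_rv_preimage.
have fib k : (\int[P]_(w in N @^-1` [set k]) (toR R X w)%:E =
    (prob P (N @^-1` [set k]) * (k%:R * m + b))%:E)%E.
  rewrite (eq_integral (fun w => (\sum_(1 <= i < k.+1) (toR R (W i) w)%:E +
                                  (toR R (W 0) w)%:E)%E)); last first.
    by move=> w; rewrite inE /= => <-; rewrite /toR XE natrD EFinD /psum natr_sum sumEFin.
  have mW i : measurable_fun (N @^-1` [set k]) (fun w => (toR R (W i) w)%:E).
    exact: (@measurable_fun_rv _ _ _ _ (fun v => v%:R) (W i)).
  have W0 i w : (0 <= (toR R (W i) w)%:E)%E by rewrite lee_fin.
  rewrite ge0_integralD//; last 2 first.
  - by move=> w _; rewrite sume_ge0.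
  - exact: emeasurable_sum.
  rewrite ge0_integral_sum//.
  rewrite (integral_indep_of (indepN k) Wb).
  rewrite big_nat_cond (eq_bigr (fun=> (prob P (N @^-1` [set k]) * m)%:E)); last first.
    by move=> i /andP[/andP[i0 _] _]; rewrite (integral_indep_of (indepN k) (Wm i i0)).
  rewrite -big_nat_cond sumEFin -EFinD sumr_const_nat subn1 /= -mulr_natl.
  by congr EFin; lra.
rewrite unlock {1}(preimage_bigcup_eq N setT) ge0_integral_bigcup.
- rewrite (eq_eseriesr (g := fun k =>
    (m%:E * (prob P (N @^-1` [set k]) * k%:R)%:E +
     b%:E * (1 * prob P (setT `&` N @^-1` [set k]))%:E)%E)).
    rewrite nneseriesD ?nneseriesZl.
    + rewrite -expectation_rv Ne -(@integral_rv _ _ _ _ (fun=> 1) N setT)//.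
      rewrite integral_cst// [X in (1%:E * X)%E](_ : _ = 1%E); last first.
        exact: probability_setT.
      by rewrite mule1 -!EFinM mulr1 -EFinD.
    + by move=> k _; rewrite lee_fin mulr_ge0 ?prob_ge0.
    + by move=> k _; rewrite lee_fin mulr_ge0 ?prob_ge0.
    + by move=> k _ _; rewrite -EFinM lee_fin !mulr_ge0 ?prob_ge0.
    + by move=> k _ _; rewrite -EFinM lee_fin !mulr_ge0 ?prob_ge0.
  by move=> k _; rewrite !setTI fib -!EFinM -EFinD; congr EFin; lra.
- by move=> k; rewrite setTI.
- rewrite -preimage_bigcup_eq; exact: (@measurable_fun_rv _ _ _ _ (fun v => v%:R) X).
- by move=> w _; rewrite lee_fin.
- exact: trivIset_fibers.
Qed.

End random_sum_expectation.

(** * Asymptotic comparison with a reference function *)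

Section eventually.
Context (R : realType).

Lemma near_scale (Q : R -> Prop) (c : R) : 0 < c ->
  (\forall x \near +oo, Q x) -> \forall x \near +oo, Q (c * x).
Proof.
move=> c0 [M [Mr MQ]]; exists (M / c); split; first exact: num_real.
by move=> x; rewrite ltr_pdivrMr// mulrC => /MQ.
Qed.

Lemma near_gt (M : R) : \forall x \near +oo, M < x.
Proof. by apply: nbhs_pinfty_gt; exact: num_real. Qed.

End eventually.

Section negligible.
Context (R : realType) (H : R -> R).
Hypothesis H0 : forall x, 0 <= H x.

(** The relation [f = o(H)] at [+oo], for nonnegative [H]. The
    multiplicative form avoids division by [H] and gives linear inequalities
    at a point. *)
Definition negl (f : R -> R) : Prop :=
  forall t, 0 < t -> \forall x \near +oo, `|f x| <= t * H x.

(** The relation [f = O(H)] at [+oo]. *)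
Definition dominated (f : R -> R) : Prop :=
  exists2 C, 0 < C & \forall x \near +oo, `|f x| <= C * H x.

(** Regular variation of [f] up to [o(H)]. Unlike regular variation
    itself it is a linear condition that is stable under adding [o(H)], and it
    allows [f] to be itself [o(H)], as the tail of [X_0] is. *)
Definition rv_class (g : R) (f : R -> R) : Prop :=
  dominated f /\ forall q, 0 < q -> negl (fun x => f (q * x) - q `^ (- g) * f x).

Lemma negl_near (f h : R -> R) :
  (\forall x \near +oo, f x = h x) -> negl f -> negl h.
Proof.
by move=> fh nf t t0; near=> x; rewrite -(near fh x)//; near: x; exact: nf.
Unshelve. all: by end_near. Qed.

Lemma eq_negl (f h : R -> R) : f =1 h -> negl f -> negl h.
Proof. by move=> fh; apply: negl_near; near=> x; exact: fh.
Unshelve. all: by end_near. Qed.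

Lemma negl0 : negl (fun=> 0).
Proof.
by move=> t t0; near=> x; rewrite normr0 mulr_ge0// ltW.
Unshelve. all: by end_near. Qed.

Lemma neglD (f h : R -> R) : negl f -> negl h -> negl (fun x => f x + h x).
Proof.
move=> nf nh t t0; have t2 : 0 < t / 2 by lra.
near=> x; apply: (le_trans (ler_normD _ _)).
have h1 : `|f x| <= t / 2 * H x by near: x; exact: nf.
have h2 : `|h x| <= t / 2 * H x by near: x; exact: nh.
by lra.
Unshelve. all: by end_near. Qed.

Lemma neglZ (c : R) (f : R -> R) : negl f -> negl (fun x => c * f x).
Proof.
move=> nf t t0; have c1 : 0 < `|c| + 1 by rewrite ltr_wpDl.
have tc : 0 < t / (`|c| + 1) by rewrite divr_gt0.
near=> x; rewrite normrM.
have : `|f x| <= t / (`|c| + 1) * H x by near: x; exact: nf.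
rewrite mulrAC ler_pdivlMr// mulrC => fx; apply: le_trans fx.
by rewrite ler_wpM2r// lerDl.
Unshelve. all: by end_near. Qed.

Lemma neglB (f h : R -> R) : negl f -> negl h -> negl (fun x => f x - h x).
Proof.
move=> nf nh; apply: eq_negl (neglD nf (neglZ (-1) nh)).
by move=> x; rewrite mulN1r.
Qed.

Lemma negl_sum (n : nat) (f : nat -> R -> R) : (forall k, negl (f k)) ->
  negl (fun x => \sum_(0 <= k < n) f k x).
Proof.
move=> nf; elim: n => [|n IHn].
  by apply: eq_negl negl0 => x; rewrite big_nil.
by apply: eq_negl (neglD IHn (nf n)) => x; rewrite big_nat_recr.
Qed.

Lemma dominatedD (f h : R -> R) :
  dominated f -> dominated h -> dominated (fun x => f x + h x).
Proof.
move=> [C C0 fC] [D D0 hD]; exists (C + D); first exact: addr_gt0.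
near=> x; apply: (le_trans (ler_normD _ _)); rewrite mulrDl lerD//; by near: x.
Unshelve. all: by end_near. Qed.

Lemma dominatedZ (c : R) (f : R -> R) :
  dominated f -> dominated (fun x => c * f x).
Proof.
move=> [C C0 fC]; exists ((`|c| + 1) * C); first by rewrite mulr_gt0// ltr_wpDl.
near=> x; rewrite normrM -mulrA ler_pM// ?lerDl//; by near: x.
Unshelve. all: by end_near. Qed.

Lemma negl_dominated (f : R -> R) : negl f -> dominated f.
Proof. by move=> nf; exists 1 => //; exact: nf. Qed.

Lemma negl_mul (f h : R -> R) : dominated f ->
  (forall t, 0 < t -> \forall x \near +oo, `|h x| <= t) ->
  negl (fun x => f x * h x).
Proof.
move=> [C C0 fC] h0 t t0; have tC : 0 < t / C by rewrite divr_gt0.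
near=> x; rewrite normrM.
have -> : t * H x = (C * H x) * (t / C) by field; rewrite gt_eqF.
by apply: ler_pM => //; near: x => //; exact: h0.
Unshelve. all: by end_near. Qed.

Lemma rv_classD (g : R) (f h : R -> R) :
  rv_class g f -> rv_class g h -> rv_class g (fun x => f x + h x).
Proof.
move=> [df nf] [dh nh]; split; first exact: dominatedD.
move=> q q0; apply: eq_negl (neglD (nf q q0) (nh q q0)) => x /=.
by lra.
Qed.

Lemma rv_classZ (g c : R) (f : R -> R) :
  rv_class g f -> rv_class g (fun x => c * f x).
Proof.
move=> [df nf]; split; first exact: dominatedZ.
move=> q q0; apply: eq_negl (neglZ c (nf q q0)) => x /=.
by lra.
Qed.

Section scaling.
Hypothesis H_scale : forall q, 0 < q -> dominated (fun x => H (q * x)).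

Lemma negl_scale (q : R) (f : R -> R) : 0 < q ->
  negl f -> negl (fun x => f (q * x)).
Proof.
move=> q0 nf t t0; have [C C0 HC] := H_scale q0.
have tC : 0 < t / C by rewrite divr_gt0.
have nfq := near_scale q0 (nf _ tC).
near=> x; apply: (@le_trans _ _ (t / C * H (q * x))); first by near: x.
have : `|H (q * x)| <= C * H x by near: x.
rewrite (ger0_norm (H0 _)) => h; rewrite mulrAC ler_pdivrMr// -mulrA.
by rewrite ler_wpM2l ?(ltW t0)// [leRHS]mulrC.
Unshelve. all: by end_near. Qed.

Lemma dominated_scale (q : R) (f : R -> R) : 0 < q ->
  dominated f -> dominated (fun x => f (q * x)).
Proof.
move=> q0 [D D0 fD]; have [C C0 HC] := H_scale q0.
exists (D * C); first exact: mulr_gt0.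
have fDq := near_scale q0 fD.
near=> x; apply: (@le_trans _ _ (D * H (q * x))); first by near: x.
have : `|H (q * x)| <= C * H x by near: x.
by rewrite (ger0_norm (H0 _)) => h; rewrite -mulrA ler_wpM2l// ltW.
Unshelve. all: by end_near. Qed.

Lemma rv_class_negl (g : R) (f : R -> R) : negl f -> rv_class g f.
Proof.
move=> nf; split; first exact: negl_dominated.
by move=> q q0; apply: neglB; [exact: negl_scale|exact: neglZ].
Qed.

Lemma rv_class_congr (g : R) (f h : R -> R) :
  negl (fun x => f x - h x) -> rv_class g h -> rv_class g f.
Proof.
move=> nfh rh; have := rv_classD (rv_class_negl g nfh) rh.
by rewrite (_ : (fun x => f x - h x + h x) = f)//; apply/funext => x; lra.
Qed.

End scaling.
End negligible.

(** * Regularly varying functions *)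

Section regular_variation.
Context (R : realType).
Implicit Types (F H : R -> R) (g : R).

Definition ratio_limits F g : Prop :=
  forall q, 0 < q -> F (q * x) / F x @[x --> +oo] --> q `^ (- g).

Lemma ratio_negl F g q : (forall x, 0 < x -> 0 < F x) -> ratio_limits F g ->
  0 < q -> negl F (fun x => F (q * x) - q `^ (- g) * F x).
Proof.
move=> Fpos rF q0 t t0.
have := rF q q0 => /cvgr_dist_le /(_ t t0) rFq.
near=> x.
have x0 : 0 < x by near: x; exact: near_gt.
have Fx := Fpos _ x0.
have : `|q `^ (- g) - F (q * x) / F x| <= t by near: x.
rewrite distrC => h.
have -> : F (q * x) - q `^ (- g) * F x = (F (q * x) / F x - q `^ (- g)) * F x.
  by rewrite mulrBl divfK// gt_eqF.
by rewrite normrM (gtr0_norm Fx) ler_wpM2r// ltW.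
Unshelve. all: by end_near. Qed.

Lemma negl_trans F H f : (forall x, 0 <= F x) -> dominated H F -> negl F f -> negl H f.
Proof.
move=> F0 [C C0 FC] nf t t0; have tC : 0 < t / C by rewrite divr_gt0.
near=> x; apply: (@le_trans _ _ (t / C * F x)); first by near: x; exact: nf.
have : `|F x| <= C * H x by near: x.
rewrite (ger0_norm (F0 _)) => h; rewrite mulrAC ler_pdivrMr// -mulrA.
by rewrite ler_wpM2l ?(ltW t0)// [leRHS]mulrC.
Unshelve. all: by end_near. Qed.

Lemma dominated_refl H : (forall x, 0 <= H x) -> dominated H H.
Proof.
move=> H0; exists 1 => //; near=> x; rewrite ger0_norm// mul1r.
Unshelve. all: by end_near. Qed.

Lemma rv_class_ratio F H g : (forall x, 0 <= F x) ->
  (forall x, 0 < x -> 0 < F x) -> ratio_limits F g ->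
  dominated H F -> rv_class H g F.
Proof.
move=> F0 Fpos rF HF; split=> // q q0.
by apply: negl_trans HF _ => //; exact: ratio_negl.
Qed.

Lemma ratio_scale F g : (forall x, 0 <= F x) -> (forall x, 0 < x -> 0 < F x) ->
  ratio_limits F g -> forall q, 0 < q -> dominated F (fun x => F (q * x)).
Proof.
move=> F0 Fpos rF q q0; exists (q `^ (- g) + 1).
  by rewrite ltr_wpDl// powR_ge0.
near=> x; rewrite ger0_norm//.
have : `|F (q * x) - q `^ (- g) * F x| <= 1 * F x.
  by near: x; exact: ratio_negl.
by rewrite ler_norml => /andP[_]; lra.
Unshelve. all: by end_near. Qed.

(** Eventually [F(2 x) / F(x)] is close to [2 `^ (- g)]; for smaller [x]
    one uses [F <= 1] and a lower bound for [F]. *)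
Lemma ratio_doubling F g : (forall x y, x <= y -> F y <= F x) ->
  (forall x, F x <= 1) -> (forall x, 0 < x -> 0 < F x) -> ratio_limits F g ->
  exists q : nat, forall x, 0 < x -> F x <= 2 ^+ q.+1 * F (2 * x).
Proof.
move=> Fdec F1 Fpos rF.
have c0 : 0 < 2 `^ (- g) / 2 :> R by rewrite divr_gt0// powR_gt0.
have [M [_ MF]] := @ratio_negl F g 2 Fpos rF (ltr0n _ 2) _ c0.
pose N := Num.max M 0 + 1.
have N0 : 0 < N by rewrite /N ltr_wpDl// le_max lexx orbT.
have MN : M < N by rewrite /N (@le_lt_trans _ _ (Num.max M 0)) ?le_max ?lexx// ltrDl.
pose B : R := Num.max ((2 `^ (- g) / 2)^-1) ((F (2 * N))^-1).
(* [B] is good both for [x > N] and for [x <= N]. *)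
have [q Bq] : exists q : nat, B <= 2 ^+ q.+1.
  exists (Num.truncn B); apply: (le_trans (ltW (truncnS_gt _))).
  by rewrite -natrX ler_nat (leq_trans _ (ltnW (ltn_expl _ _))).
exists q => x x0.
have F2 : 0 < F (2 * x) by rewrite Fpos// mulr_gt0.
apply: (@le_trans _ _ (B * F (2 * x))); last by rewrite ler_wpM2r// ltW.
have [xN|Nx] := leP x N.
  apply: (le_trans (F1 x)); apply: (@le_trans _ _ ((F (2 * N))^-1 * F (2 * x))).
    rewrite mulrC ler_pdivlMr ?Fpos ?mulr_gt0// mul1r Fdec// ler_wpM2l//.
  by rewrite ler_wpM2r ?(ltW F2)// /B le_max lexx orbT.
apply: (@le_trans _ _ ((2 `^ (- g) / 2)^-1 * F (2 * x))); last first.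
  by rewrite ler_wpM2r ?(ltW F2)// /B le_max lexx.
rewrite mulrC ler_pdivlMr// mulrC.
have := MF x (lt_trans MN Nx); rewrite ler_norml => /andP[+ _]; lra.
Qed.

End regular_variation.

Section bigO.
Context (R : realType).
(** A finite upper limit of [F / H] means that [F / H] has a finite
    supremum on some neighbourhood of [+oo]. *)
Lemma dominated_bigO (F H : R -> R) : (forall x, 0 <= F x) ->
  (forall x, 0 < x -> 0 < H x) -> asymp_bigO F H -> dominated H F.
Proof.
move=> F0 Hpos /ereal_inf_lt[_ [A nA <-]] supA.
have [M AM] : exists M : R, forall x, A x -> F x / H x <= M.
  move: supA; set S := ereal_sup _ => S1.
  have SA x : A x -> ((F x / H x)%:E <= S)%E.
    by move=> Ax; apply: ereal_sup_ubound; exists x.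
  move: S1 SA; case: S => [M| |] // _ SA.
    by exists M => x /SA; rewrite lee_fin.
  by exists 0 => x /SA; rewrite leeNy_eq.
exists (Num.max M 1); first by rewrite lt_max ltr01 orbT.
near=> x.
have x0 : 0 < x by near: x; exact: near_gt.
have Ax : A x by near: x.
have := AM x Ax; rewrite ler_pdivrMr ?Hpos// ger0_norm// => h.
by apply: (le_trans h); rewrite ler_wpM2r ?(ltW (Hpos _ x0))// le_max lexx.
Unshelve. all: by end_near. Qed.
End bigO.

(** * Moments and regular variation *)

Section powers.
Context (R : realType).

Lemma gt1_ltr_powRr (a x y : R) : 1 < a -> x < y -> a `^ x < a `^ y.
Proof.
move=> a1 xy; rewrite /powR gt_eqF ?(lt_trans ltr01)//.
by rewrite ltr_expR ltr_pM2r// ln_gt0.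
Qed.

Lemma powR_near1_lt (g t : R) : 0 < g -> 0 < t ->
  exists2 a, 0 < a < 1 & a `^ (- g) <= 1 + t.
Proof.
move=> g0 t0; exists ((1 + t) `^ (- g^-1)); last first.
  by rewrite -powRrM mulrNN mulVf ?gt_eqF// powRr1//; lra.
rewrite powR_gt0 ?addr_gt0//= powRN invf_lt1 ?powR_gt0 ?addr_gt0//.
rewrite -[ltLHS](powRr0 (1 + t)); apply: gt1_ltr_powRr; last by rewrite invr_gt0.
by lra.
Qed.

Lemma powR_near1_gt (g t : R) : 0 < g -> 0 < t < 1 ->
  exists2 a, 1 < a & 1 - t <= a `^ (- g).
Proof.
move=> g0 /andP[t0 t1]; exists ((1 - t) `^ (- g^-1)); last first.
  by rewrite -powRrM mulrNN mulVf ?gt_eqF// powRr1//; lra.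
have t1' : 0 < 1 - t by lra.
rewrite powRN invf_gt1 ?powR_gt0//.
rewrite -[ltRHS](congr1 (fun f => f g^-1) (powR1 R)).
by apply: gt0_ltr_powR; rewrite ?nnegrE ?invr_gt0//; lra.
Qed.

End powers.

Section regularly_varying_tails.
Context d (T : measurableType d) (R : realType) (P : probability T R).

Lemma sum_pmf_le (Y : {RV P >-> nat}) n n' :
  \sum_(n <= v < n') prob P (Y @^-1` [set v]) <= prob P [set w | (n <= Y w)%N].
Proof.
have [n'n|nn'] := leqP n' n; first by rewrite big_geq// prob_ge0.
set A := [set w | _].
have mA : measurable A by exact: (measurable_rv_set Y (fun v => (n <= v)%N)).
rewrite (eq_big_nat _ _ (F2 := fun v => prob P (A `&` Y @^-1` [set v]))); last first.
  move=> v /andP[nv _]; congr prob; apply/seteqP; split=> w /=; last by case.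
  by move=> Yv; split=> //; rewrite /A /= Yv.
apply: (@le_trans _ _ (\sum_(0 <= v < n') prob P (A `&` Y @^-1` [set v]))).
  rewrite [leRHS](big_cat_nat (n := n))//=; last exact: ltnW.
  by rewrite lerDr sumr_ge0// => v _; exact: prob_ge0.
rewrite -prob_fibers//; apply: le_prob => //.
by apply: measurableI => //; exact: (measurable_rv_set Y (fun v => (v < n')%N)).
Qed.

(** Along [x_j = 2^j N] the quantity [x_j F(x_j)] decreases geometrically
    because [2 * 2 `^ (- g) < 1], and it controls, up to a factor 2, the
    contribution to the mean of the values between [x_j] and [x_(j+1)]. *)
Lemma rv_mean_lty (Y : {RV P >-> nat}) (g : R) : 1 < g ->
  (forall x, 0 < x -> 0 < tail P (toR R Y) x) ->
  ratio_limits (tail P (toR R Y)) g -> ('E_P[toR R Y] < +oo)%E.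
Proof.
move=> g1 Fpos rF; set F := tail P (toR R Y) in Fpos rF.
have pg : 2 * 2 `^ (- g) < 1 :> R.
  have : 2 `^ (- g) < 2 `^ (- 1) :> R by apply: gt1_ltr_powRr; lra.
  by rewrite powR_inv1//; lra.
set c := 2 `^ (- g) in pg.
pose rho : R := (1 + 2 * c) / 2.
have c0 : 0 < c by exact: powR_gt0.
have t0 : 0 < rho / 2 - c by rewrite /rho; lra.
have rho0 : 0 < rho by rewrite /rho; lra.
have rho1 : rho < 1 by rewrite /rho; lra.
have [M [_ MF]] := @ratio_negl R F g 2 Fpos rF (ltr0n _ 2) _ t0.
have F2 x : M < x -> F (2 * x) <= rho / 2 * F x.
  by move=> /MF; rewrite -/c ler_norml => /andP[_]; lra.
pose N := (Num.truncn M).+1.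
have MN : M < N%:R by exact: truncnS_gt.
pose x j : R := 2 ^+ j * N%:R.
have xE j : x j = (2 ^ j * N)%:R by rewrite natrM natrX.
have Mx j : M < x j.
  apply: (lt_le_trans MN); rewrite xE ler_nat leq_pmull// expn_gt0//.
have xF j : x j * F (x j) <= rho ^+ j * (x 0%N * F (x 0%N)).
  elim: j => [|j IHj]; first by rewrite expr0 mul1r.
  have x0 : 0 <= x j by rewrite xE.
  have xS : x j.+1 = 2 * x j by rewrite /x exprS mulrA.
  rewrite xS exprS -mulrA.
  apply: (@le_trans _ _ (rho * (x j * F (x j)))); last first.
    by rewrite -mulrA ler_wpM2l// ltW.
  by have := ler_wpM2l x0 (F2 _ (Mx j)); lra.
pose S n := \sum_(0 <= v < n) prob P (Y @^-1` [set v]) * v%:R.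
have SS j : S (2 ^ j.+1 * N).+1 <= S (2 ^ j * N).+1 + 2 * (x j * F (x j)).
  have le : ((2 ^ j * N).+1 <= (2 ^ j.+1 * N).+1)%N.
    by rewrite ltnS leq_mul2r expnS leq_pmull ?orbT.
  rewrite /S (big_cat_nat (n := (2 ^ j * N).+1))//= lerD2l.
  apply: (@le_trans _ _ (\sum_((2 ^ j * N).+1 <= v < (2 ^ j.+1 * N).+1)
     prob P (Y @^-1` [set v]) * (2 * x j))).
    rewrite big_nat_cond [leRHS]big_nat_cond.
    apply: ler_sum => v /andP[/andP[_ vj] _]; rewrite ler_wpM2l ?prob_ge0//.
    by rewrite xE -natrM ler_nat mulnA -expnS.
  rewrite -mulr_suml mulrC -mulrA ler_wpM2l// ler_wpM2l ?xE//.
  apply: (le_trans (sum_pmf_le _ _ _)); apply: le_prob.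
  - exact: (measurable_rv_set Y (fun v => (2 ^ j * N < v)%N)).
  - exact: (measurable_rv_set Y (fun v => (2 ^ j * N)%:R < v%:R)).
  - by move=> w /=; rewrite /toR ltr_nat.
pose K := 2 * (x 0%N * F (x 0%N)) / (1 - rho).
have K0 : 0 <= K.
  rewrite /K !mulr_ge0 ?xE ?tail_ge0// ?invr_ge0; last by lra.
have SK j : S (2 ^ j * N).+1 <= S (N.+1) + K * (1 - rho ^+ j).
  elim: j => [|j IHj]; first by rewrite expn0 mul1n expr0 subrr mulr0 addr0.
  apply: (le_trans (SS j)).
  have -> : K * (1 - rho ^+ j.+1) =
    K * (1 - rho ^+ j) + 2 * (rho ^+ j * (x 0%N * F (x 0%N))).
    by rewrite /K exprS; field; rewrite gt_eqF//; lra.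
  by have := xF j; lra.
apply: (@expectation_lty_of_partial _ _ _ _ _ (S N.+1 + K)) => n.
apply: (@le_trans _ _ (S (2 ^ n * N).+1)).
  have nN : (n <= (2 ^ n * N).+1)%N.
    by rewrite (leq_trans (ltnW (ltn_expl n (ltnSn 1))))// leqW// leq_pmulr.
  rewrite [leRHS](big_cat_nat (n := n))//= lerDl sumr_ge0// => v _.
  by rewrite mulr_ge0 ?prob_ge0.
apply: (le_trans (SK n)); rewrite lerD2l ler_piMr//.
by have : 0 <= rho ^+ n; [rewrite exprn_ge0// ltW|lra].
Qed.

End regularly_varying_tails.

(** Along [2^j N] the function [H] loses at most a factor [rho] at each
    step, where [rho] lies strictly between [2 `^ (- r)] and [2 `^ (- g)],
    whereas [x `^ (- r)] loses the factor [2 `^ (- r) < rho]. *)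
Lemma negl_power_tail (R : realType) (H G : R -> R) (g r C : R) :
  (forall x y, x <= y -> H y <= H x) -> (forall x, 0 < x -> 0 < H x) ->
  ratio_limits H g -> 0 <= r -> g < r -> (forall x, 0 <= G x) -> 0 <= C ->
  (forall x, 0 < x -> x `^ r * G x <= C) -> negl H G.
Proof.
move=> Hdec Hpos rH r0 gr G0 C0 HG t t0.
set b : R := 2 `^ (- r); set c : R := 2 `^ (- g).
have b0 : 0 < b by exact: powR_gt0.
have bc : b < c by apply: gt1_ltr_powRr; lra.
have [rho rhoE] : exists rho, rho = (b + c) / 2 by exists ((b + c) / 2).
have rho0 : 0 < rho by rewrite rhoE; lra.
have s0 : 0 < c - rho by rewrite rhoE; lra.
have [M [_ MF]] := @ratio_negl R H g 2 Hpos rH (ltr0n _ 2) _ s0.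
(* Any positive number beyond which the ratio bound holds. *)
pose N := Num.max M 0 + 1.
have N0 : 0 < N by rewrite /N ltr_wpDl// le_max lexx orbT.
have MN : M < N by rewrite /N (@le_lt_trans _ _ (Num.max M 0)) ?le_max ?lexx// ltrDl.
have x0 j : 0 < 2 ^+ j * N by rewrite mulr_gt0// exprn_gt0.
have HN j : rho ^+ j * H N <= H (2 ^+ j * N).
  elim: j => [|j IHj]; first by rewrite !expr0 !mul1r.
  rewrite !exprS -!mulrA; apply: (@le_trans _ _ (rho * H (2 ^+ j * N))).
    by rewrite ler_wpM2l// ltW.
  have : M < 2 ^+ j * N.
    by apply: (lt_le_trans MN); rewrite ler_peMl ?(ltW N0)// exprn_ege1// ler1n.
  by move=> /MF; rewrite -/c ler_norml => /andP[+ _]; rewrite rhoE; lra.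
have HNpos := Hpos _ N0.
pose K := C / (N `^ r * (rho * H N)).
have K0 : 0 <= K.
  by rewrite /K divr_ge0// ltW// mulr_gt0 ?powR_gt0// mulr_gt0.
have th1 : `|b / rho| < 1.
  by rewrite ger0_norm ?divr_ge0 ?ltW// ltr_pdivrMr// mul1r rhoE; lra.
have tK : 0 < t / (K + 1) by rewrite divr_gt0// ltr_wpDl.
have /cvgr0_norm_le /(_ _ tK) [j0 _ Hj0] := cvg_expr th1.
near=> x.
have xN : 2 ^+ j0 * N < x by near: x; exact: near_gt.
have Nx : 0 < x by apply: lt_trans xN.
have ex : exists j, x < 2 ^+ j.+1 * N.
  exists (Num.truncn (x / N)); rewrite -ltr_pdivrMr//.
  apply: (lt_trans (truncnS_gt _)).
  rewrite -natrX ltr_nat (leq_trans _ (ltn_expl _ _))//.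
case: (ex_minnP ex) => j xj jmin.
have jx : 2 ^+ j * N <= x.
  case: j jmin xj => [jmin _|j jmin _].
    rewrite expr0 mul1r (le_trans _ (ltW xN))// ler_peMl ?(ltW N0)//.
    by rewrite exprn_ege1// ler1n.
  by rewrite leNgt; apply/negP => /jmin; rewrite ltnn.
have j0j : (j0 <= j)%N.
  rewrite -ltnS -(ltr_eXn2l (x := 2%:R : R)) ?ltr1n//.
  by rewrite -(ltr_pM2r N0) (lt_trans xN).
have := Hj0 j j0j; rewrite ger0_norm ?exprn_ge0 ?divr_ge0 ?(ltW b0) ?(ltW rho0)// => thj.
have hH : rho ^+ j.+1 * H N <= H x by apply: (le_trans (HN j.+1)); exact/Hdec/ltW.
have hG : (2 ^+ j * N) `^ r * G x <= C.
  by apply: le_trans (HG x Nx); rewrite ler_wpM2r// ge0_ler_powR// nnegrE ltW.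
have e1 : (2 ^+ j * N) `^ r = N `^ r / b ^+ j.
  rewrite powRM ?exprn_ge0 ?(ltW N0)// mulrC; congr (_ * _).
  rewrite /b -powR_mulrn ?powR_ge0// -powRrM mulNr powRN invrK.
  by rewrite -powR_mulrn// -powRrM mulrC.
have Nr0 : 0 < N `^ r by exact: powR_gt0.
have bj : 0 < b ^+ j by exact: exprn_gt0.
have rj : 0 < rho ^+ j by exact: exprn_gt0.
have hG2 : G x <= C * b ^+ j / N `^ r.
  by rewrite ler_pdivlMr// mulrC -ler_pdivrMr// mulrAC -e1.
rewrite ger0_norm//; apply: (le_trans hG2).
have e2 : C * b ^+ j / N `^ r = K * (b / rho) ^+ j * (rho ^+ j.+1 * H N).
  rewrite /K exprS expr_div_n; field.
  by rewrite !gt_eqF.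
rewrite e2; apply: ler_pM => //.
- apply: mulr_ge0 => //; apply: exprn_ge0; exact/ltW/divr_gt0.
- apply: mulr_ge0; [apply: exprn_ge0; exact: ltW|exact: ltW].
apply: (@le_trans _ _ (K * (t / (K + 1)))); first by rewrite ler_wpM2l.
rewrite mulrA ler_pdivrMr; last by rewrite ltr_wpDl.
by rewrite mulrC ler_wpM2l ?(ltW t0)// lerDl.
Unshelve. all: by end_near. Qed.

(** * The tail of a sum of two independent variables *)

Section sum_of_independent.
Context d (T : measurableType d) (R : realType) (P : probability T R).
Context (H : R -> R) (g : R).
Hypothesis H0 : forall x, 0 <= H x.
Hypothesis g0 : 0 < g.
Hypothesis H_scale : forall q, 0 < q -> dominated H (fun x => H (q * x)).
Hypothesis H_cvg0 : forall t, 0 < t -> \forall x \near +oo, H x <= t.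

Lemma dominated_cvg0 (f : R -> R) : dominated H f ->
  forall t, 0 < t -> \forall x \near +oo, `|f x| <= t.
Proof.
move=> [C C0 fC] t t0; have tC : 0 < t / C by rewrite divr_gt0.
near=> x; apply: (@le_trans _ _ (C * H x)); first by near: x.
rewrite mulrC -ler_pdivlMr//; near: x; exact: H_cvg0.
Unshelve. all: by end_near. Qed.

(** The limit factor [a `^ (- g)] tends to 1 when [a] does, so that
    shrinking the argument a little costs only a small multiple of [H]. *)
Lemma rv_class_shrink (f : R -> R) (t : R) : (forall x, 0 <= f x) ->
  rv_class H g f -> 0 < t -> exists2 a, 0 < a < 1 &
  \forall x \near +oo, f (a * x) <= f x + t * H x.
Proof.
move=> f0 [[C C0 fC] nf] t0.
have tC : 0 < t / (2 * C) by rewrite divr_gt0// mulr_gt0.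
have [a /andP[a0 a1] ag] := powR_near1_lt g0 tC.
exists a; first by rewrite a0.
have t2 : 0 < t / 2 by lra.
have nfa := nf a a0 _ t2.
near=> x.
have h1 : `|f (a * x) - a `^ (- g) * f x| <= t / 2 * H x by near: x.
have h2 : `|f x| <= C * H x by near: x.
rewrite (ger0_norm (f0 _)) in h2.
have h3 : a `^ (- g) * f x <= (1 + t / (2 * C)) * f x by rewrite ler_wpM2r.
have h4 : t / (2 * C) * f x <= t / (2 * C) * (C * H x) by rewrite ler_wpM2l// ltW.
have h5 : t / (2 * C) * (C * H x) = t / 2 * H x by field; rewrite gt_eqF.
by move: h1; rewrite ler_norml => /andP[_]; lra.
Unshelve. all: by end_near. Qed.

Lemma rv_class_grow (f : R -> R) (t : R) : (forall x, 0 <= f x) ->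
  rv_class H g f -> 0 < t -> exists2 a, 1 < a &
  \forall x \near +oo, f x - t * H x <= f (a * x).
Proof.
move=> f0 [[C C0 fC] nf] t0.
pose s := Num.min (t / (2 * C)) (1 / 2).
have tC : 0 < t / (2 * C) by rewrite divr_gt0// mulr_gt0.
have s01 : 0 < s < 1.
  apply/andP; split; first by rewrite /s lt_min tC/=; lra.
  by rewrite /s gt_min; apply/orP; right; lra.
have [a a1 ag] := powR_near1_gt g0 s01.
have a0 : 0 < a by apply: lt_trans a1.
exists a => //.
have t2 : 0 < t / 2 by lra.
have nfa := nf a a0 _ t2.
near=> x.
have h1 : `|f (a * x) - a `^ (- g) * f x| <= t / 2 * H x by near: x.
have h2 : `|f x| <= C * H x by near: x.
rewrite (ger0_norm (f0 _)) in h2.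
have h3 : (1 - s) * f x <= a `^ (- g) * f x by rewrite ler_wpM2r.
have h4 : s * f x <= t / (2 * C) * (C * H x).
  have s0 : 0 <= s by case/andP: s01 => /ltW.
  by apply: ler_pM => //; rewrite /s ge_min lexx.
have h5 : t / (2 * C) * (C * H x) = t / 2 * H x by field; rewrite gt_eqF.
by move: h1; rewrite ler_norml => /andP[+ _]; lra.
Unshelve. all: by end_near. Qed.

Context (U V Z : {RV P >-> nat}).
Hypothesis ZE : forall w, Z w = (U w + V w)%N.
Hypothesis indepUV : forall B C : set nat,
  prob P (U @^-1` B `&` V @^-1` C) = prob P (U @^-1` B) * prob P (V @^-1` C).

Let f := tail P (toR R U).
Let h := tail P (toR R V).

Lemma tail_inter x y :
  prob P ([set w | x < (U w)%:R] `&` [set w | y < (V w)%:R]) = f x * h y.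
Proof. exact: (indepUV (fun v => x < v%:R) (fun v => y < v%:R)). Qed.

(** One summand above [x] suffices; inclusion-exclusion. *)
Lemma tail_add_ge x : 0 <= x -> f x + h x - f x * h x <= tail P (toR R Z) x.
Proof.
move=> x0; rewrite -tail_inter.
set A := [set w | x < (U w)%:R]; set B := [set w | x < (V w)%:R].
have mA : measurable A by exact: (measurable_rv_set U (fun v => x < v%:R)).
have mB : measurable B by exact: (measurable_rv_set V (fun v => x < v%:R)).
have -> : f x + h x - prob P (A `&` B) = prob P (A `|` (B `\` A)).
  rewrite prob_setU//; last 2 first.
  - exact: measurableD.
  - by rewrite setDE setICA setICr setI0.
  have := prob_setID P mB mA; rewrite -setDE setIC /f /h !tailE -/A -/B.
  by lra.
apply: le_prob.
- by apply: measurableU => //; exact: measurableD.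
- exact: (measurable_rv_set Z (fun v => x < v%:R)).
- move=> w [|[]] /=; rewrite /A /B /= /toR ZE natrD.
    by move=> xU; rewrite (lt_le_trans xU)// lerDl.
  by move=> xV _; rewrite (lt_le_trans xV)// lerDr.
Qed.

(** If the sum exceeds [a + b] and neither summand exceeds [a], then both
    exceed [b]. *)
Lemma tail_add_le x a b : x = a + b ->
  tail P (toR R Z) x <= f a + h a + f b * h b.
Proof.
move=> xab; rewrite -tail_inter.
set A := [set w | a < (U w)%:R]; set B := [set w | a < (V w)%:R].
set C := _ `&` _.
have mA : measurable A by exact: (measurable_rv_set U (fun v => a < v%:R)).
have mB : measurable B by exact: (measurable_rv_set V (fun v => a < v%:R)).
have mC : measurable C.
  apply: measurableI; first exact: (measurable_rv_set U (fun v => b < v%:R)).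
  exact: (measurable_rv_set V (fun v => b < v%:R)).
apply: (@le_trans _ _ (prob P (A `|` B `|` C))).
  apply: le_prob.
  - exact: (measurable_rv_set Z (fun v => x < v%:R)).
  - by apply: measurableU => //; exact: measurableU.
  move=> w /=; rewrite /toR ZE natrD xab => ab.
  have [Ua|Ua] := ltP a (U w)%:R; first by left; left.
  have [Va|Va] := ltP a (V w)%:R; first by left; right.
  by right; split => /=; lra.
apply: (le_trans (prob_setU_le _ (measurableU _ _ mA mB) mC)).
by rewrite lerD2r; exact: prob_setU_le.
Qed.

(** A sum of two independent variables is large when one of them is: both
    being large has probability [O(H) * o(1)], and the loss from [x] to [a x]
    is small by [rv_class_shrink]. *)
Lemma tail_add_negl : rv_class H g f -> rv_class H g h ->
  negl H (fun x => tail P (toR R Z) x - (f x + h x)).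
Proof.
move=> rf rh t t0.
have f0 x : 0 <= f x by exact: tail_ge0.
have h0 x : 0 <= h x by exact: tail_ge0.
have t4 : 0 < t / 4 by lra.
have [a1 /andP[a10 a11] fa] := rv_class_shrink f0 rf t4.
have [a2 /andP[a20 a21] ha] := rv_class_shrink h0 rh t4.
pose a := Num.max a1 a2.
have a1a : a1 <= a by rewrite /a le_max lexx.
have a2a : a2 <= a by rewrite /a le_max lexx orbT.
have a1' : a < 1 by rewrite /a gt_max a11.
have b0 : 0 < 1 - a by lra.
have nfh : negl H (fun x => f ((1 - a) * x) * h ((1 - a) * x)).
  have [df _] := rf; have [dh _] := rh.
  apply: negl_mul; first exact: dominated_scale.
  by apply: dominated_cvg0; exact: dominated_scale.
have nfh1 : negl H (fun x => f x * h x).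
  have [df _] := rf; have [dh _] := rh.
  by apply: negl_mul => //; exact: dominated_cvg0.
near=> x.
have x0 : 0 < x by near: x; exact: near_gt.
have h1 : `|f ((1 - a) * x) * h ((1 - a) * x)| <= t / 4 * H x by near: x; exact: nfh.
have h2 : `|f x * h x| <= t / 4 * H x by near: x; exact: nfh1.
have h3 : f (a1 * x) <= f x + t / 4 * H x by near: x.
have h4 : h (a2 * x) <= h x + t / 4 * H x by near: x.
have h5 : f (a * x) <= f (a1 * x).
  by apply: tail_nonincreasing; rewrite ler_wpM2r// ltW.
have h6 : h (a * x) <= h (a2 * x).
  by apply: tail_nonincreasing; rewrite ler_wpM2r// ltW.
have up : tail P (toR R Z) x <= f (a * x) + h (a * x) + f ((1 - a) * x) * h ((1 - a) * x).
  by apply: tail_add_le; lra.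
have lo := tail_add_ge (ltW x0).
have Hx := H0 x.
have tH : 0 <= t * H x by rewrite mulr_ge0// ltW.
rewrite ler_norml; move: h1 h2; rewrite !ler_norml => /andP[_ h1] /andP[_ h2].
by apply/andP; split; lra.
Unshelve. all: by end_near. Qed.

End sum_of_independent.

(** * Random sums *)

Section random_sum.
Context d (T : measurableType d) (R : realType) (P : probability T R).
Context (W : nat -> {RV P >-> nat}) (xi N : {RV P >-> nat}).
Hypothesis indepW : indep_of W setT setT.
Hypothesis indepN : forall k, indep_of W setT (N @^-1` [set k]).
Hypothesis Wxi : forall i (B : set nat), (0 < i)%N ->
  prob P (W i @^-1` B) = prob P (xi @^-1` B).

Definition rsum : T -> nat := fun w => psum W (N w) w.

Lemma indep_of_rsum (B : set nat) :
  indep_of W [set 0%N] (rsum @^-1` B).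
Proof.
rewrite (preimage_bigcup_eq N (rsum @^-1` B)).
apply: indep_of_bigcup => [|k]; first exact: trivIset_fibers.
have -> : rsum @^-1` B `&` N @^-1` [set k] = N @^-1` [set k] `&`
    [set w | (fun l => B (sumn l)) [seq W i w | i <- iota 1 k]].
  apply/seteqP; split=> w [] /=; rewrite /rsum.
    by move=> + Nw; rewrite Nw psumE.
  by move=> Nw; rewrite -psumE Nw.
apply: (indep_of_map (fun l => B (sumn l)) (iota_uniq 1 k) _ _ (indepN k)) => //.
by move=> _ /= ->; split=> //; rewrite /= mem_iota.
Qed.

Lemma measurable_rsum : measurable_fun setT rsum.
Proof.
by move=> _ B _; rewrite setTI; have [] := indep_of_rsum B.
Qed.

HB.instance Definition _ := isMeasurableFun.Build _ _ _ _ rsum measurable_rsum.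

Lemma indep_of_rv (B : set nat) : indep_of W setT (N @^-1` B).
Proof.
rewrite (preimage_bigcup_eq N (N @^-1` B)).
apply: indep_of_bigcup => [|k]; first exact: trivIset_fibers.
have [Bk|Bk] := pselect (B k).
  rewrite (_ : _ `&` _ = N @^-1` [set k])//.
  by apply/seteqP; split=> w /= => [[]//|Nw]; rewrite Nw.
rewrite (_ : _ `&` _ = set0); first by split=> // s C _ _; rewrite set0I measure0 mul0e.
by apply/seteqP; split=> // w /= [+ Nw]; rewrite Nw.
Qed.

Lemma prob_indep_rv (B C : set nat) k :
  prob P (N @^-1` B `&` psum W k @^-1` C) =
  prob P (N @^-1` B) * prob P (psum W k @^-1` C).
Proof.
have CE : psum W k @^-1` C = [set w | (fun l => C (sumn l)) [seq W i w | i <- iota 1 k]].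
  by apply/seteqP; split=> w /=; rewrite psumE.
rewrite CE.
have mC := measurable_map W (iota 1 k) (fun l => C (sumn l)).
have mN := measurable_rv_preimage N B.
apply: EFin_inj; rewrite EFinM -!probE//; last exact: measurableI.
apply: (indep_of_prob_map (fun l => C (sumn l)) indepW (indep_of_rv B)) => //.
exact: iota_uniq.
Qed.

Lemma prob_rsum_lt (x : R) K :
  prob P ([set w | x < (rsum w)%:R] `&` [set w | (N w < K)%N]) =
  \sum_(0 <= k < K) prob P (N @^-1` [set k]) * tail P (toR R (psum W k)) x.
Proof.
rewrite prob_fibers; last first.
  exact: (measurable_rv_set (rsum : {RV P >-> nat}) (fun v => x < v%:R)).
apply: eq_bigr => k _; rewrite tailE -(prob_indep_rv _ (fun v => x < v%:R)) setIC.
by congr prob; apply/seteqP; split=> w /= [Nw]; rewrite /rsum Nw.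
Qed.

Lemma leq_psum k n w : (k <= n)%N -> (psum W k w <= psum W n w)%N.
Proof.
by move=> kn; rewrite /psum [leqRHS](big_cat_nat (n := k.+1))//= leq_addr.
Qed.

Lemma tail_rsum_le (x y : R) : 0 <= y ->
  tail P (toR R rsum) x <=
  \sum_(0 <= k < (Num.truncn y).+1)
     prob P (N @^-1` [set k]) * tail P (toR R (psum W k)) x
  + tail P (toR R N) y.
Proof.
move=> y0; rewrite -prob_rsum_lt !tailE.
have m1 : measurable [set w | x < (rsum w)%:R].
  exact: (measurable_rv_set (rsum : {RV P >-> nat}) (fun v => x < v%:R)).
have m2 := measurable_rv_set N (fun v => (v < (Num.truncn y).+1)%N).
have m3 := measurable_rv_set N (fun v => y < v%:R).
have m12 := measurableI _ _ m1 m2.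
apply: le_trans (prob_setU_le _ m12 m3); apply: le_prob => //; first exact: measurableU.
move=> w /= xw; have [yN|Ny] := ltP y (N w)%:R; [by right|left; split=> //].
by rewrite ltnS truncn_ge_nat.
Qed.

(** When [N] exceeds [y] the sum contains the first [truncn y + 1]
    terms, a number of terms that does not depend on [N]. *)
Lemma tail_rsum_ge (x y : R) K : 0 <= y -> (K <= (Num.truncn y).+1)%N ->
  \sum_(0 <= k < K) prob P (N @^-1` [set k]) * tail P (toR R (psum W k)) x
  + tail P (toR R N) y * tail P (toR R (psum W (Num.truncn y).+1)) x <=
  tail P (toR R rsum) x.
Proof.
move=> y0 Ky; set n := (Num.truncn y).+1 in Ky *.
have m1 : measurable [set w | x < (rsum w)%:R].
  exact: (measurable_rv_set (rsum : {RV P >-> nat}) (fun v => x < v%:R)).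
have m2 := measurable_rv_set N (fun v => (v < K)%N).
rewrite -prob_rsum_lt [leRHS](prob_setID P m1 m2) lerD2l !tailE.
rewrite -(prob_indep_rv (fun v => y < v%:R) (fun v => x < v%:R)).
apply: le_prob.
- apply: measurableI; first exact: measurable_rv_preimage.
  exact: (measurable_rv_preimage (psum W n : {RV P >-> nat})).
- by apply: measurableI => //; exact: measurableC.
move=> w [/= yN xS].
have nN : (n <= N w)%N by rewrite /n -ltnS ltnS truncn_lt_nat.
split; first by rewrite /= (lt_le_trans xS)// ler_nat leq_psum.
by apply/negP; rewrite -leqNgt (leq_trans Ky).
Qed.

End random_sum.

(** * The tail of a random sum *)

Section random_sum_tail.
Context d (T : measurableType d) (R : realType) (P : probability T R).
Context (W : nat -> {RV P >-> nat}) (xi N : {RV P >-> nat}).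
Hypothesis indepW : indep_of W setT setT.
Hypothesis indepN : forall k, indep_of W setT (N @^-1` [set k]).
Hypothesis Wxi : forall i (B : set nat), (0 < i)%N ->
  prob P (W i @^-1` B) = prob P (xi @^-1` B).
Context (H : R -> R) (g : R).
Hypothesis H0 : forall x, 0 <= H x.
Hypothesis g0 : 0 < g.
Hypothesis H_scale : forall q, 0 < q -> dominated H (fun x => H (q * x)).
Hypothesis H_cvg0 : forall t, 0 < t -> \forall x \near +oo, H x <= t.
Let F := tail P (toR R xi).
Let G := tail P (toR R N).
Hypothesis F_gt0 : forall x, 0 < x -> 0 < F x.
Hypothesis F_rv : rv_class H g F.
Variable q : nat.
Hypothesis F_doubling : forall x, 0 < x -> F x <= 2 ^+ q.+1 * F (2 * x).
Hypothesis xi_lty : ('E_P[toR R xi] < +oo)%E.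
Let m := fine ('E_P[toR R xi])%E.
Hypothesis m_gt0 : 0 < m.
Hypothesis G_rv : rv_class H g G.
Hypothesis N_lty : ('E_P[toR R N] < +oo)%E.
Let e := fine ('E_P[toR R N])%E.

Let F0 x : 0 <= F x. Proof. exact: tail_ge0. Qed.
Let G0 x : 0 <= G x. Proof. exact: tail_ge0. Qed.
Let p k := prob P (N @^-1` [set k]).
Let p0 k : 0 <= p k. Proof. exact: prob_ge0. Qed.
Let S k := tail P (toR R (psum W k)).

Lemma tail_psum_negl k : negl H (fun x => S k x - k%:R * F x).
Proof.
elim: k => [|k IHk].
  apply: negl_near (negl0 H0); near=> x.
  have x0 : 0 < x by near: x; exact: near_gt.
  rewrite mul0r subr0 /S tailE (_ : [set _ | _] = set0) ?prob_set0//.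
  by apply/seteqP; split=> // w /=; rewrite psum0 ltNge (ltW x0).
have WE : tail P (toR R (W k.+1)) = F.
  by apply/funext => x; exact: (Wxi (fun v => x < v%:R)).
have rS : rv_class H g (S k).
  by apply: rv_class_congr IHk _ => //; exact: rv_classZ.
have := @tail_add_negl _ _ _ P H g H0 g0 H_scale H_cvg0 (psum W k) (W k.+1) (psum W k.+1)
  (fun w => psumS W k w) _ rS.
rewrite WE => /(_ _ F_rv) h.
have {}h : negl H (fun x => S k.+1 x - (S k x + F x)).
  apply: h => B C.
  have BE : psum W k @^-1` B =
      [set w | (fun l => B (sumn l)) [seq W i w | i <- iota 1 k]].
    by apply/seteqP; split=> w /=; rewrite psumE.
  rewrite setIC BE (prob_indep_map indepW C (fun l => B (sumn l))) ?iota_uniq 1?mulrC//.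
  by rewrite mem_iota add1n ltnn andbF.
apply: eq_negl (neglD h IHk) => x /=.
by rewrite -natr1; lra.
Unshelve. all: by end_near. Qed.

Lemma sum_tail_psum_negl K : negl H (fun x =>
  \sum_(0 <= k < K) p k * S k x - (\sum_(0 <= k < K) p k * k%:R) * F x).
Proof.
have := negl_sum H0 K (fun k => neglZ (p k) (tail_psum_negl k)).
apply: eq_negl => x; rewrite mulr_suml -sumrB; apply: eq_bigr => k _.
by rewrite mulrBr mulrA.
Qed.

Lemma tail_scale_mean_negl : negl H (fun x => G (m^-1 * x) - m `^ g * G x).
Proof.
have [_ /(_ m^-1)] := G_rv; rewrite invr_gt0 => /(_ m_gt0).
by rewrite -[m^-1]powR_inv1 ?(ltW m_gt0)// -powRrM mulrNN mul1r.
Qed.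

Lemma tail_scale_mean_rv : rv_class H g (fun x => G (m^-1 * x)).
Proof.
apply: rv_class_congr tail_scale_mean_negl _ => //.
exact: rv_classZ.
Qed.

(** The threshold [y = a x / m], with [a < 1], is such that more than
    [y] terms are as likely as more than [x / m] terms, up to a small multiple
    of [H], whereas fewer terms have total mean at most [a x]. Among the values
    of [N] up to [y], the first [K] are treated exactly, and the uniform bound
    [tail_psum_le] reduces the others to the tail of the series of [E(N)]. *)
Lemma tail_rsum_upper t : 0 < t -> \forall x \near +oo,
  tail P (toR R (rsum W N)) x <= e * F x + m `^ g * G x + t * H x.
Proof.
move=> t0; have t4 : 0 < t / 4 by lra.
have G'0 x : 0 <= G (m^-1 * x) by [].
have [a /andP[a0 a1] Ga] := rv_class_shrink g0 G'0 tail_scale_mean_rv t4.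
have eta0 : 0 < (1 - a) / 2 by lra.
have eta1 : (1 - a) / 2 <= 1 by lra.
have [C C0 nagaev] := tail_psum_le indepW Wxi
  (fun n => partial_mean_le n xi_lty) F_gt0 F_doubling eta0 eta1.
have b0 : 0 < 1 - a by lra.
have [D D0 FD] : dominated H (fun x => F ((1 - a) * x)).
  by apply: dominated_scale => //; case: F_rv.
(* The remaining mean of [N] is multiplied by [C * D]; the summand 1 only keeps
   the denominator positive. *)
have tau0 : 0 < t / (4 * (C * D + 1)).
  by rewrite divr_gt0// mulr_gt0// ltr_wpDl// mulr_ge0// ltW.
have [K eK] : exists K, e - t / (4 * (C * D + 1)) <= \sum_(0 <= k < K) p k * k%:R.
  by apply: partial_mean_ge => //; rewrite -/e; lra.
near=> x.
have x0 : 0 < x by near: x; exact: near_gt.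
have h1 : G (m^-1 * (a * x)) <= G (m^-1 * x) + t / 4 * H x by near: x.
have h2 : `|G (m^-1 * x) - m `^ g * G x| <= t / 4 * H x.
  by near: x; exact: tail_scale_mean_negl.
have h3 : `|\sum_(0 <= k < K) p k * S k x - (\sum_(0 <= k < K) p k * k%:R) * F x| <=
    t / 4 * H x by near: x; exact: sum_tail_psum_negl.
have h4 : `|F ((1 - a) * x)| <= D * H x by near: x.
rewrite (ger0_norm (F0 _)) in h4.
set y := m^-1 * (a * x) in h1.
have y0 : 0 <= y by rewrite /y !mulr_ge0 ?invr_ge0// ltW.
have my : y * m = a * x by rewrite /y mulrC mulrA divff ?mul1r// gt_eqF.
set n := (Num.truncn y).+1.
have Kn : (K <= n)%N.
  rewrite /n leqW// truncn_ge_nat// /y.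
  have : K%:R * m / a <= x by near: x; apply: nbhs_pinfty_ge; exact: num_real.
  by rewrite ler_pdivrMr// mulrC ler_pdivlMl// [_ * x]mulrC [m * _]mulrC.
have up := tail_rsum_le indepW indepN x y0.
have h5 : \sum_(K <= k < n) p k * S k x <= t / 4 * H x.
  apply: (@le_trans _ _ (\sum_(K <= k < n) (p k * k%:R) * (C * (D * H x)))).
    rewrite big_nat_cond [leRHS]big_nat_cond.
    apply: ler_sum => k /andP[/andP[_ kn] _]; rewrite -mulrA ler_wpM2l//.
    have ky : k%:R <= y by rewrite -truncn_ge_nat// -ltnS.
    have kmx : k%:R * m <= a * x by rewrite -my ler_wpM2r// ltW.
    apply: (@le_trans _ _ (S k (k%:R * m + (1 - a) * x))).
      by apply: tail_nonincreasing; lra.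
    have y'0 : 0 < (1 - a) * x by rewrite mulr_gt0.
    apply: (le_trans (nagaev k _ y'0 _)).
      have : (1 - a) / 2 * (k%:R * m) <= (1 - a) / 2 * (a * x).
        by rewrite ler_wpM2l// ltW.
      have : (1 - a) / 2 * (a * x) <= (1 - a) / 2 * x.
        by rewrite ler_wpM2l ?(ltW eta0)// ler_piMl ?(ltW x0)// ltW.
      by rewrite -/m; lra.
    by rewrite mulrCA ler_wpM2l// ler_wpM2l.
  rewrite -mulr_suml.
  have : \sum_(0 <= k < n) p k * k%:R <= e by exact: partial_mean_le.
  rewrite (big_cat_nat (n := K))//= => hn.
  have hs : \sum_(K <= k < n) p k * k%:R <= t / (4 * (C * D + 1)) by lra.
  apply: (@le_trans _ _ (t / (4 * (C * D + 1)) * (C * (D * H x)))).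
    by rewrite ler_wpM2r// !mulr_ge0// ltW.
  have -> : t / (4 * (C * D + 1)) * (C * (D * H x)) = t / 4 * H x * (C * D / (C * D + 1)).
    by field; rewrite gt_eqF// ltr_wpDl// mulr_ge0// ltW.
  rewrite ler_piMr//; first by rewrite mulr_ge0// ltW.
  by rewrite ler_pdivrMr ?mul1r ?lerDl// ltr_wpDl// mulr_ge0// ltW.
move: up; rewrite (big_cat_nat (n := K))//= -/(p _) => up.
have h6 : (\sum_(0 <= k < K) p k * k%:R) * F x <= e * F x.
  by rewrite ler_wpM2r//; exact: partial_mean_le.
move: h2 h3; rewrite !ler_norml => /andP[_ h2] /andP[_ h3].
apply: (le_trans up).
by move: h1 h2 h3 h5 h6; rewrite /y /S /p /G; lra.
Unshelve. all: by end_near. Qed.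

(** Now [y = a x / m] with [a > 1], so that more than [y] terms have
    total mean at least [a x] and their sum exceeds [x] up to a vanishing
    probability. *)
Lemma tail_rsum_lower t : 0 < t -> \forall x \near +oo,
  e * F x + m `^ g * G x - t * H x <= tail P (toR R (rsum W N)) x.
Proof.
move=> t0; have t5 : 0 < t / 5 by lra.
have G'0 x : 0 <= G (m^-1 * x) by [].
have [a a1 Ga] := rv_class_grow g0 G'0 tail_scale_mean_rv t5.
have a0 : 0 < a by apply: lt_trans a1.
have [[D D0 FD] _] := F_rv.
have tau0 : 0 < t / (5 * D) by rewrite divr_gt0// mulr_gt0.
have [K eK] : exists K, e - t / (5 * D) <= \sum_(0 <= k < K) p k * k%:R.
  by apply: partial_mean_ge => //; rewrite -/e; lra.
have [E E0 GE] : dominated H (fun x => G (m^-1 * (a * x))).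
  apply: (dominated_scale H0 H_scale (f := fun x => G (m^-1 * x))) => //.
  by case: tail_scale_mean_rv.
(* With [mu < m] and [y * mu = (1 + a) / 2 * x], the sum of [n >= y] terms
   stays above [x] unless it deviates by a multiple of [x]. *)
pose mu := m * ((1 + a) / (2 * a)).
have mum : mu < m.
  rewrite /mu gtr_pMr// ltr_pdivrMr ?mulr_gt0//; lra.
have mu0 : 0 < mu by rewrite /mu mulr_gt0// divr_gt0 ?mulr_gt0//; lra.
have [s s0 low] := prob_psum_le indepW Wxi
  (fun u => @partial_mean_ge _ _ _ _ _ u xi_lty) mum.
have tE : 0 < t / (5 * E) by rewrite divr_gt0// mulr_gt0.
near=> x.
have x0 : 0 < x by near: x; exact: near_gt.
have h1 : G (m^-1 * x) - t / 5 * H x <= G (m^-1 * (a * x)) by near: x.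
have h2 : `|G (m^-1 * x) - m `^ g * G x| <= t / 5 * H x.
  by near: x; exact: tail_scale_mean_negl.
have h3 : `|\sum_(0 <= k < K) p k * S k x - (\sum_(0 <= k < K) p k * k%:R) * F x| <=
    t / 5 * H x by near: x; exact: sum_tail_psum_negl.
have h4 : `|F x| <= D * H x by near: x.
rewrite (ger0_norm (F0 _)) in h4.
have h5 : `|G (m^-1 * (a * x))| <= E * H x by near: x.
rewrite (ger0_norm (G0 _)) in h5.
set y := m^-1 * (a * x) in h1 h5.
have y0 : 0 <= y by rewrite /y !mulr_ge0 ?invr_ge0// ltW.
set n := (Num.truncn y).+1.
have Kn : (K <= n)%N.
  rewrite /n leqW// truncn_ge_nat// /y.
  have : K%:R * m / a <= x by near: x; apply: nbhs_pinfty_ge; exact: num_real.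
  by rewrite ler_pdivrMr// mulrC ler_pdivlMl// [_ * x]mulrC [m * _]mulrC.
have lo := tail_rsum_ge indepW indepN x y0 Kn.
have yn : y <= n%:R by exact/ltW/truncnS_gt.
have h6 : 1 - S n x <= t / (5 * E).
  rewrite /S -prob_le_tail; apply: (le_trans (low n x (ltW x0))).
  have h7 : y * mu <= n%:R * mu by rewrite ler_wpM2r// ltW.
  have ymu : y * mu = (1 + a) / 2 * x.
    by rewrite /y /mu; field; rewrite !gt_eqF.
  have h8 : s * (x - n%:R * mu) <= - (s * ((a - 1) / 2 * x)).
    by rewrite -[leRHS]mulrN ler_wpM2l ?(ltW s0)//; lra.
  apply: (@le_trans _ _ (expR (- (s * ((a - 1) / 2 * x))))); first by rewrite ler_expR.
  rewrite -[leRHS]lnK ?posrE// ler_expR.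
  have c0 : 0 < s * ((a - 1) / 2) by rewrite mulr_gt0//; lra.
  have : - ln (t / (5 * E)) / (s * ((a - 1) / 2)) <= x.
    by near: x; apply: nbhs_pinfty_ge; exact: num_real.
  by rewrite ler_pdivrMr//; lra.
have h7 : G y * (1 - S n x) <= t / 5 * H x.
  apply: (@le_trans _ _ (E * H x * (t / (5 * E)))).
    apply: ler_pM => //; rewrite subr_ge0; exact: tail_le1.
  by rewrite le_eqVlt; apply/orP; left; apply/eqP; field; rewrite gt_eqF.
have h8 : (e - t / (5 * D)) * F x <= (\sum_(0 <= k < K) p k * k%:R) * F x.
  by rewrite ler_wpM2r.
have h9 : t / (5 * D) * F x <= t / (5 * D) * (D * H x) by rewrite ler_wpM2l// ltW.
have h10 : t / (5 * D) * (D * H x) = t / 5 * H x by field; rewrite gt_eqF.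
move: h2 h3; rewrite !ler_norml => /andP[h2 _] /andP[h3 _].
apply: le_trans lo.
by move: h1 h2 h3 h7 h8 h9 h10; rewrite /S /p /G /n /y; lra.
Unshelve. all: by end_near. Qed.

Lemma tail_rsum_negl :
  negl H (fun x => tail P (toR R (rsum W N)) x - (e * F x + m `^ g * G x)).
Proof.
move=> t t0; near=> x; rewrite ler_norml; apply/andP; split.
  rewrite lerBrDl addrC.
  have : e * F x + m `^ g * G x - t * H x <= tail P (toR R (rsum W N)) x.
    by near: x; exact: tail_rsum_lower.
  by lra.
rewrite lerBlDl.
by near: x; exact: tail_rsum_upper.
Unshelve. all: by end_near. Qed.

End random_sum_tail.

(** * The branching recursion *)

Section coefficients.
Context (R : realType).

Lemma sum_expr_revS (z : R) n :
  \sum_(1 <= j < n.+2) z ^+ (n.+1 - j) =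
  1 + z * \sum_(1 <= j < n.+1) z ^+ (n - j).
Proof.
rewrite big_nat_recr//= subnn expr0 addrC mulr_sumr; congr (_ + _).
by apply: eq_big_nat => j /andP[_ jn]; rewrite -exprS subSn.
Qed.

(** The geometric sums are kept unevaluated since [r = 1] occurs, namely
    when [gamma = 1]. *)
Definition geom (r : R) n := \sum_(0 <= i < n) r ^+ i.

Lemma geomS r n : geom r n.+1 = 1 + r * geom r n.
Proof.
rewrite /geom big_nat_recl// expr0 mulr_sumr; congr (_ + _).
by apply: eq_bigr => i _; rewrite exprS.
Qed.

(** The coefficient of the mean immigration in [c_n], for
    [r = m `^ (gamma - 1)]. *)
Definition immigration_coef (m r : R) n :=
  \sum_(1 <= j < n) m ^+ (n - j - 1) * geom r (n - j).

Lemma immigration_coefS m r n : immigration_coef m r n.+1 =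
  \sum_(1 <= j < n.+1) m ^+ (n - j) + m * r * immigration_coef m r n.
Proof.
rewrite /immigration_coef.
have -> : \sum_(1 <= j < n.+1) m ^+ (n.+1 - j - 1) * geom r (n.+1 - j) =
  \sum_(1 <= j < n.+1) m ^+ (n - j) +
  \sum_(1 <= j < n.+1) m ^+ (n - j) * (r * geom r (n - j)).
  rewrite -big_split/=; apply: eq_big_nat => j /andP[_ jn].
  by rewrite subSn// subn1/= geomS mulrDr mulr1.
congr (_ + _); case: n => [|n]; first by rewrite !big_geq// mulr0.
rewrite [LHS]big_nat_recr//= subnn /geom [X in r * X]big_geq// !mulr0 addr0 mulr_sumr.
apply: eq_big_nat => j /andP[_ jn].
have -> : (n.+1 - j = (n.+1 - j - 1).+1)%N by rewrite subn1 prednK// subn_gt0.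
by rewrite exprS subSS subn0; ring.
Qed.

End coefficients.

Section process.
Context d (T : measurableType d) (R : realType) (P : probability T R).
Context (X : nat -> {RV P >-> nat}) (xi : nat -> nat -> {RV P >-> nat})
  (eps : nat -> {RV P >-> nat}).
Hypothesis gwi : is_gwi X xi eps.

Let Y := gwi_family (X 0%N) xi eps.

Definition index_after (n : nat) : set (unit + nat * nat + nat)%type :=
  [set k | match k with
           | inl (inl _) => false
           | inl (inr (a, i)) => (n < a)%N && (0 < i)%N
           | inr a => (n < a)%N
           end].

(** The variables acting at time [n], with the immigration term placed at
    0, where the sum of offspring leaves a free place. *)
Definition generation (n i : nat) : (unit + nat * nat + nat)%type :=
  if i is _.+1 then inl (inr (n, i)) else inr n.

Lemma generation_inj n : injective (generation n).
Proof. by move=> [|i] [|j] //= [->]. Qed.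

Lemma generation_index_after n i : index_after n (generation n.+1 i).
Proof. by case: i => [|i]; rewrite /index_after /= ltnSn. Qed.

Let W n : nat -> {RV P >-> nat} := fun i => Y (generation n i).

Lemma gwi_recursion n w : X n.+1 w = (psum (W n.+1) (X n w) w + W n.+1 0 w)%N.
Proof.
have [_ _ _ XE] := gwi.
rewrite XE//=; congr (_ + _)%N; rewrite /psum big_nat [RHS]big_nat.
by apply: eq_bigr => -[|i].
Qed.

Lemma indep_of_index_after0 : indep_of Y (index_after 0) setT.
Proof.
have [/indep_of_family iY _ _ _] := gwi.
by apply: indep_of_subset iY => -[[[]|[a i]]|a].
Qed.

(** By induction on [n]: on the event [X n = j], the value of [X n.+1] is a
    function of finitely many variables acting at time [n.+1]. *)
Lemma indep_of_past n k : indep_of Y (index_after n) (X n @^-1` [set k]).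
Proof.
have [/indep_of_family iY _ _ _] := gwi.
elim: n k => [|n IHn] k.
  have i0 : gwi_index (inl (inl tt)) by [].
  have := indep_of_setI [set k] i0 iY.
  rewrite setTI; apply: indep_of_subset => -[[[]|[a i]]|a] //=.
rewrite (preimage_bigcup_eq (X n) (X n.+1 @^-1` [set k])).
apply: indep_of_bigcup => [|j]; first exact: trivIset_fibers.
pose s := [seq generation n.+1 i | i <- iota 0 j.+1].
have sE w : sumn [seq Y i w | i <- s] = (psum (W n.+1) j w + W n.+1 0 w)%N.
  by rewrite /s -map_comp /= addnC psumE.
have -> : X n.+1 @^-1` [set k] `&` X n @^-1` [set j] = X n @^-1` [set j] `&`
    [set w | (fun l => sumn l = k) [seq Y i w | i <- s]].
  apply/seteqP; split=> w [h1 h2].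
    move: h1 h2 => /= <- Xn; split=> //.
    by change (sumn [seq Y i w | i <- s] = X n.+1 w); rewrite sE gwi_recursion Xn.
  have {}h2 : sumn [seq Y i w | i <- s] = k := h2.
  by move: h1 => /= Xn; split=> //=; rewrite gwi_recursion Xn -sE.
apply: (indep_of_map (fun l => sumn l = k) (D := index_after n)) => //.
- by rewrite map_inj_uniq ?iota_uniq//; exact: generation_inj.
- by move=> i /= /mapP[v _ ->]; exact: generation_index_after.
move=> [[[]|[a i]]|a] //=.
  move=> /andP[na i0]; split; first by rewrite /= (ltn_trans _ na)//.
  move=> /= /mapP[[|v] _ //= [an _]]; move: na; rewrite an ltnn//.
move=> na; split; first by rewrite /= (ltn_trans _ na)//.
by move=> /= /mapP[[|v] _ //= [an]]; move: na; rewrite an ltnn.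
Qed.

Lemma indep_of_generation n (A : set T) :
  indep_of Y (index_after n) A -> indep_of (W n.+1) setT A.
Proof.
apply: (indep_of_reindex (f := generation n.+1)); first exact: generation_inj.
exact: generation_index_after.
Qed.

Lemma indep_of_generationT n : indep_of (W n.+1) setT setT.
Proof.
apply: indep_of_generation; apply: indep_of_subset indep_of_index_after0.
move=> [[[]|[a i]]|a] //=; last exact: leq_ltn_trans.
by move=> /andP[na ->]; rewrite (leq_ltn_trans _ na).
Qed.

Lemma generation_xi n i (B : set nat) : (0 < i)%N ->
  prob P (W n.+1 i @^-1` B) = prob P (xi 1%N 1%N @^-1` B).
Proof.
have [_ idxi _ _] := gwi; case: i => // i _.
congr fine; exact: (idxi n.+1 i.+1 isT isT B).
Qed.

Lemma generation_eps n (B : set nat) :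
  prob P (W n.+1 0 @^-1` B) = prob P (eps 1%N @^-1` B).
Proof. have [_ _ ideps _] := gwi; congr fine; exact: (ideps n.+1 isT B). Qed.

Section one_generation.
Context (H : R -> R) (g : R).
Let F := tail P (toR R (xi 1%N 1%N)).
Hypothesis HE : H = tail P (toR R (eps 1%N)).
Hypothesis g0 : 0 < g.
Hypothesis H_scale : forall q, 0 < q -> dominated H (fun x => H (q * x)).
Hypothesis H_cvg0 : forall t, 0 < t -> \forall x \near +oo, H x <= t.
Hypothesis F_gt0 : forall x, 0 < x -> 0 < F x.
Hypothesis F_rv : rv_class H g F.
Hypothesis H_rv : rv_class H g H.
Variable q : nat.
Hypothesis F_doubling : forall x, 0 < x -> F x <= 2 ^+ q.+1 * F (2 * x).
Variables (m b : R).
Hypothesis xi_mean : ('E_P[toR R (xi 1%N 1%N)] = m%:E)%E.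
Hypothesis eps_mean : ('E_P[toR R (eps 1%N)] = b%:E)%E.
Hypothesis m_gt0 : 0 < m.

Let H0 x : 0 <= H x. Proof. by rewrite HE; exact: tail_ge0. Qed.

Lemma expectation_eq_law (U V : {RV P >-> nat}) :
  (forall B, prob P (U @^-1` B) = prob P (V @^-1` B)) ->
  ('E_P[toR R U] = 'E_P[toR R V])%E.
Proof.
by move=> UV; rewrite !expectation_rv; apply: eq_eseriesr => v _; rewrite UV.
Qed.

Lemma expectation_generation n e : ('E_P[toR R (X n)] = e%:E)%E ->
  ('E_P[toR R (X n.+1)] = (m * e + b)%:E)%E.
Proof.
apply: (expectation_random_sum (W := W n.+1)).
- by move=> k; apply: indep_of_generation; exact: indep_of_past.
- exact: gwi_recursion.
- move=> i i0; rewrite -xi_mean; apply: expectation_eq_law => B.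
  exact: generation_xi.
- by rewrite -eps_mean; apply: expectation_eq_law => B; exact: generation_eps.
Qed.

(** One step of the recursion for the coefficients of [F] and [H]. *)
Lemma tail_generation n e c D : ('E_P[toR R (X n)] = e%:E)%E ->
  negl H (fun x => tail P (toR R (X n)) x - (c * F x + D * H x)) ->
  negl H (fun x => tail P (toR R (X n.+1)) x -
    ((e + m `^ g * c) * F x + (m `^ g * D + 1) * H x)).
Proof.
move=> Xe IH.
have indepW := indep_of_generationT n.
have indepN k : indep_of (W n.+1) setT (X n @^-1` [set k]).
  by apply: indep_of_generation; exact: indep_of_past.
have G_rv : rv_class H g (tail P (toR R (X n))).
  apply: rv_class_congr IH _ => //.
  by apply: rv_classD => //; exact: rv_classZ.
pose N' : {RV P >-> nat} := X n.
have rs : negl H (fun x => tail P (toR R (rsum (W n.+1) N')) x -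
    (e * F x + m `^ g * tail P (toR R (X n)) x)).
  have := @tail_rsum_negl _ _ _ P (W n.+1) (xi 1%N 1%N) (X n) indepW indepN
    (generation_xi n) H g H0 g0 H_scale H_cvg0 F_gt0 F_rv q F_doubling.
  by rewrite Xe xi_mean /=; apply=> //; exact: ltry.
have WH : tail P (toR R (W n.+1 0%N)) = H.
  rewrite HE; apply/funext => x.
  exact: (generation_eps n (fun v => x < v%:R)).
have rs_rv : rv_class H g (tail P (toR R (rsum (W n.+1) N'))).
  apply: rv_class_congr rs _ => //.
  by apply: rv_classD => //; exact: rv_classZ.
have := @tail_add_negl _ _ _ P H g H0 g0 H_scale H_cvg0
  (rsum (W n.+1) N') (W n.+1 0%N) (X n.+1) (gwi_recursion n) _ rs_rv.
rewrite WH => /(_ indepN _ H_rv) h.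
have {}h : negl H (fun x => tail P (toR R (X n.+1)) x -
    (tail P (toR R (rsum (W n.+1) N')) x + H x)).
  apply: h => B C.
  have [mU iU] := indep_of_rsum indepN B.
  have := iU [:: 0%N] (fun=> C) isT.
  rewrite set_cons1 bigcap_set1 big_seq1 => /(_ (fun i Hi => Hi)) PE.
  have mC := measurable_rv_preimage (W n.+1 0%N) C.
  by apply: EFin_inj; rewrite EFinM -!probE//; exact: measurableI.
apply: eq_negl (neglD h (neglD rs (neglZ (m `^ g) IH))) => x /=.
by rewrite /N'; lra.
Qed.

End one_generation.

End process.

(** * Conclusion *)

Section conclusions.
Context (R : realType) (H f h : R -> R) (g : R).
Hypothesis H_gt0 : forall x, 0 < x -> 0 < H x.
Hypothesis Hh : forall x, H x <= h x.
Hypothesis fh : negl H (fun x => f x - h x).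

(** As [h] dominates [H], an error that is [o(H)] is also [o(h)]. *)
Lemma negl_asymp_equiv : asymp_equiv f h.
Proof.
apply/cvgrPdist_le => t t0; near=> x.
have x0 : 0 < x by near: x; exact: near_gt.
have hx : 0 < h x by apply: lt_le_trans (Hh x); exact: H_gt0.
have -> : 1 - f x / h x = - ((f x - h x) / h x).
  by rewrite mulrBl divff ?gt_eqF// opprB.
rewrite normrN normrM normfV (gtr0_norm hx) ler_pdivrMr//.
apply: (@le_trans _ _ (t * H x)); last by rewrite ler_wpM2l// ltW.
by near: x; exact: fh.
Unshelve. all: by end_near. Qed.

(** As [f] is eventually at least [H / 2], one can divide by it. *)
Lemma rv_class_ratio_limits : rv_class H g f -> ratio_limits f g.
Proof.
move=> [_ nf] q q0; apply/cvgrPdist_le => t t0.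
have t2 : 0 < t / 2 by lra.
have nfq := nf q q0 _ t2.
have h2 : 0 < 1 / 2 :> R by lra.
near=> x.
have x0 : 0 < x by near: x; exact: near_gt.
have Hx := H_gt0 x0.
have fhx : `|f x - h x| <= 1 / 2 * H x by near: x; exact: fh.
have fx : H x / 2 <= f x.
  by move: fhx; rewrite ler_norml => /andP[+ _]; have := Hh x; lra.
have fx0 : 0 < f x by lra.
have -> : q `^ (- g) - f (q * x) / f x = - ((f (q * x) - q `^ (- g) * f x) / f x).
  by rewrite mulrBl mulfK ?gt_eqF// opprB.
rewrite normrN normrM normfV (gtr0_norm fx0) ler_pdivrMr//.
apply: (@le_trans _ _ (t / 2 * H x)); first by near: x.
by rewrite -mulrA ler_wpM2l ?(ltW t0)//; lra.
Unshelve. all: by end_near. Qed.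

End conclusions.

Theorem proposition2p5 (R : realType) (d : measure_display)
    (T : measurableType d) (P : probability T R)
    (X : nat -> {RV P >-> nat}) (xi : nat -> nat -> {RV P >-> nat})
    (eps : nat -> {RV P >-> nat}) (gamma : R) :
  let m_xi : \bar R := ('E_P[toR R (xi 1%N 1%N)])%E in
  let m_eps : \bar R := ('E_P[toR R (eps 1%N)])%E in
  is_gwi X xi eps ->
  1 <= gamma ->
  regularly_varying P (toR R (xi 1%N 1%N)) gamma ->
  regularly_varying P (toR R (eps 1%N)) gamma ->
  asymp_bigO (tail P (toR R (xi 1%N 1%N))) (tail P (toR R (eps 1%N))) ->
  (exists r : R, gamma < r /\
     ('E_P[fun w => (toR R (X 0%N) w `^ r)%R] < +oo)%E) ->
  (gamma = 1 -> (0 < m_xi < +oo)%E /\ (0 < m_eps < +oo)%E) ->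
  (* the three expectations are finite under the hypotheses, so that [fine]
     loses nothing *)
  let m := fine m_xi in
  let b := fine m_eps in
  let e0 := fine ('E_P[toR R (X 0%N)])%E in
  forall n : nat, (1 <= n)%N ->
    asymp_equiv (tail P (toR R (X n)))
      (fun x =>
         e0 * m ^+ (n - 1) * (\sum_(0 <= i < n) m `^ (i%:R * (gamma - 1)))
           * tail P (toR R (xi 1%N 1%N)) x
         + b * (\sum_(1 <= j < n) m ^+ (n - j - 1)
                  * \sum_(0 <= i < n - j) m `^ (i%:R * (gamma - 1)))
           * tail P (toR R (xi 1%N 1%N)) x
         + (\sum_(1 <= j < n.+1) m `^ ((n - j)%:R * gamma))
           * tail P (toR R (eps 1%N)) x)
    /\ regularly_varying P (toR R (X n)) gamma.
Proof.
move=> m_xi m_eps gwi g1 [_ _ F_gt0 F_lim] [_ _ H_gt0 H_lim] FO [r [gr X0r]] meang m b e0.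
set F := tail P (toR R (xi 1%N 1%N)) in F_gt0 F_lim FO *.
set H := tail P (toR R (eps 1%N)) in H_gt0 H_lim FO *.
have g0 : 0 < gamma by apply: lt_le_trans g1.
have F0 x : 0 <= F x by exact: tail_ge0.
have H0 x : 0 <= H x by exact: tail_ge0.
have F_dec x y : x <= y -> F y <= F x by exact: tail_nonincreasing.
have H_dec x y : x <= y -> H y <= H x by exact: tail_nonincreasing.
have [xi_lty eps_lty] : (m_xi < +oo)%E /\ (m_eps < +oo)%E.
  have [gE|g1'] := eqVneq gamma 1.
    by have [/andP[_ ?] /andP[_ ?]] := meang gE.
  have {}g1' : 1 < gamma by rewrite lt_neqAle eq_sym g1'.
  by split; apply: (rv_mean_lty g1').
have H_scale := ratio_scale H0 H_gt0 H_lim.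
have H_cvg0 := tail_cvg0 eps_lty.
have FH : dominated H F by exact: dominated_bigO.
have F_rv : rv_class H gamma F by exact: rv_class_ratio.
have H_rv : rv_class H gamma H by apply: rv_class_ratio => //; exact: dominated_refl.
have [q F_doubling] := ratio_doubling F_dec (@tail_le1 _ _ _ P (xi 1%N 1%N)) F_gt0 F_lim.
have xi_mean : ('E_P[toR R (xi 1%N 1%N)] = m%:E)%E by exact: expectation_rv_fin.
have eps_mean : ('E_P[toR R (eps 1%N)] = b%:E)%E by exact: expectation_rv_fin.
have m_gt0 : 0 < m.
  apply: lt_le_trans (tail_markov xi_lty ltr01).
  by rewrite mul1r; exact: F_gt0.
have b0 : 0 <= b by apply: fine_ge0; exact: expectation_rv_ge0.
have r1 : 1 <= r by lra.
have X0_lty := expectation_lty_of_powR r1 X0r.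
have X0_mean : ('E_P[toR R (X 0%N)] = e0%:E)%E by exact: expectation_rv_fin.
have e00 : 0 <= e0 by apply: fine_ge0; exact: expectation_rv_ge0.
(* All powers in the statement are powers of [m] and of [rr]. *)
pose rr := m `^ (gamma - 1).
have rr0 : 0 <= rr by exact: powR_ge0.
have mg : m `^ gamma = m * rr.
  rewrite /rr -[X in X * _](powRr1 (ltW m_gt0)) -powRD; last first.
    by apply/implyP => _; rewrite gt_eqF.
  by congr powR; lra.
have sum_geom n : \sum_(0 <= i < n) m `^ (i%:R * (gamma - 1)) = geom rr n.
  apply: eq_bigr => i _; rewrite mulrC powRrM powR_mulrn//.
have sum_pow n : \sum_(1 <= j < n.+1) m `^ ((n - j)%:R * gamma) =
    \sum_(1 <= j < n.+1) (m * rr) ^+ (n - j).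
  by apply: eq_bigr => j _; rewrite mulrC powRrM powR_mulrn ?powR_ge0// mg.
have sum_imm n : \sum_(1 <= j < n) m ^+ (n - j - 1)
    * \sum_(0 <= i < n - j) m `^ (i%:R * (gamma - 1)) = immigration_coef m rr n.
  by apply: eq_bigr => j _; rewrite sum_geom.
pose c n := e0 * m ^+ (n - 1) * geom rr n + b * immigration_coef m rr n.
pose D n := \sum_(1 <= j < n.+1) (m * rr) ^+ (n - j).
pose en n := m ^+ n * e0 + b * \sum_(1 <= j < n.+1) m ^+ (n - j).
have main n : ('E_P[toR R (X n)] = (en n)%:E)%E /\
    negl H (fun x => tail P (toR R (X n)) x - (c n * F x + D n * H x)).
  elim: n => [|n [IHe IHt]].
    split; first by rewrite /en big_geq// expr0 mul1r mulr0 addr0.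
    have r0 : 0 <= r by lra.
    have C0 : 0 <= fine ('E_P[fun w => (toR R (X 0%N) w `^ r)%R])%E.
      by apply: fine_ge0; apply: expectation_ge0 => w; exact: powR_ge0.
    have := negl_power_tail H_dec H_gt0 H_lim r0 gr
      (tail_ge0 P (toR R (X 0%N))) C0 (tail_powR_le r0 X0r).
    apply: eq_negl => x.
    by rewrite /c /D /immigration_coef /geom !big_geq//; lra.
  split.
    rewrite (expectation_generation gwi xi_mean eps_mean IHe).
    by rewrite /en sum_expr_revS exprS; congr EFin; lra.
  have := tail_generation gwi (erefl H) g0 H_scale H_cvg0 F_gt0 F_rv H_rv
    F_doubling xi_mean m_gt0 IHe IHt.
  apply: eq_negl => x; congr (_ - (_ * _ + _ * _)); last first.
    by rewrite /D sum_expr_revS mg addrC.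
  rewrite /c mg subn1 /= immigration_coefS geomS /en.
  case: n {IHe IHt} => [|n].
    rewrite /geom /immigration_coef !big_geq//; lra.
  by rewrite subn1 /= exprS; ring.
move=> n n1.
have [_ nt] := main n.
have geom0 k : 0 <= geom rr k by rewrite sumr_ge0// => i _; rewrite exprn_ge0.
have c0 : 0 <= c n.
  rewrite /c addr_ge0// mulr_ge0//; first by rewrite mulr_ge0// exprn_ge0// ltW.
  by rewrite sumr_ge0// => i _; rewrite mulr_ge0// exprn_ge0// ltW.
have D1 : 1 <= D n.
  case: n n1 {nt c0} => // n _; rewrite /D sum_expr_revS lerDl.
  by rewrite mulr_ge0 ?sumr_ge0// => *; rewrite ?exprn_ge0// mulr_ge0// ltW.
have Hh x : H x <= c n * F x + D n * H x.
  by rewrite (@le_trans _ _ (D n * H x)) ?ler_peMl// lerDr mulr_ge0.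
have X_rv : rv_class H gamma (tail P (toR R (X n))).
  apply: rv_class_congr nt _ => //.
  by apply: rv_classD => //; exact: rv_classZ.
split.
  set gg := (X in asymp_equiv _ X).
  have -> : gg = (fun x => c n * F x + D n * H x).
    by apply/funext => x; rewrite /gg sum_geom sum_imm sum_pow /c /D; lra.
  exact: negl_asymp_equiv H_gt0 Hh nt.
split.
- by split=> [|w]; [exact: measurableT_comp|rewrite /toR].
- exact: ltW.
- move=> x x0; apply: (lt_le_trans (H_gt0 x x0)).
  have [_ _ ideps XE] := gwi.
  have -> : H x = tail P (toR R (eps n)) x.
    by congr fine; apply/esym; exact: (ideps n n1 [set v | x < v%:R]).
  apply: le_prob.
  + exact: (measurable_rv_set (eps n) (fun v => x < v%:R)).
  + exact: (measurable_rv_set (X n) (fun v => x < v%:R)).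
  + by move=> w /=; rewrite /toR XE// natrD => /lt_le_trans; apply; rewrite lerDr.
- exact: rv_class_ratio_limits nt X_rv.
Qed.
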